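(* Let $\mathscr X$ be a rigid $C^*$-tensor category with simple unit object such that $Irr(\mathscr X)$ is finite. Let $A$ be an algebra over $\mathbb C$, $p\ge1$, $(\mathbf H,\mathbf F)$ a $p$-summable Fredholm module over $A$ taking values in $\mathbf{Hilb}(\mathscr X)$, and $n=2m$ an even integer with $n\ge p-1$. For any $\theta\in\mathbf{Hilb}(\mathscr X)(\mathbf H,\mathbf H)$ such that $[\mathbf F,\theta]\in\mathcal S_1(\mathbf H)$, let $$Tr_s(\theta)=\tfrac12\,Trace(\varepsilon\mathbf F[\mathbf F,\theta]).$$ The following hold: (1) If $\theta$ (with $[\mathbf F,\theta]\in\mathcal S_1(\mathbf H)$) is homogeneous of odd degree, then $Tr_s(\theta)=0$. (2) If $\theta\in\mathcal S_1(\mathbf H)$, then $Tr_s(\theta)=Trace(\varepsilon\theta)$. (3) $[\mathbf F,\Omega^n]\subseteq\mathcal S_1(\mathbf H)$. (4) $Tr_s|_{\Omega^n}:\Omega^n\to\mathbb C$ is a closed graded trace of dimension $n$ on the differential graded algebra $(\Omega,d)$.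
   Context: **Rigid $C^*$-tensor category.** $\mathscr X$ is an abelian $\mathbb C$-linear strict monoidal category $(\mathscr X,\otimes,1)$ with finite-dimensional hom-spaces, equipped with antilinear maps $(\cdot)^*:\mathscr X(a,b)\to\mathscr X(b,a)$ with $f^{**}=f$, $(g\circ f)^*=f^*\circ g^*$, $(g\otimes f)^*=g^*\otimes f^*$ (structure isomorphisms unitary), such that (i) for each $f\in\mathscr X(a,b)$ there is $g\in\mathscr X(a,a)$ with $f^*\circ f=g^*\circ g$; (ii) $\|f\|^2:=\sup\{|\xi|: f^*\circ f-\xi 1_a \text{ not invertible}\}$ defines complete submultiplicative norms with $\|f^*\circ f\|=\|f\|^2$. Every object has a dual and a predual, and the unit object $1$ is simple. (Then $\mathscr X$ is semisimple: each object is a finite direct sum of simple objects.) $Irr(\mathscr X)$ is a fixed set of representatives of isomorphism classes of simple objects. **$\mathbf{Hilb}(\mathscr X)$.** $\mathbf{Hilb}$ is the category of separable complex Hilbert spaces and bounded operators. Objects of $\mathbf{Hilb}(\mathscr X)$ are linear dagger functors $\mathbf H:\mathscr X^{op}\to\mathbf{Hilb}$; morphisms $\mathbf H\to\mathbf K$ are natural transformations $\theta=(\theta_c)_c$ with $\sup_{c\in\mathscr X}|\theta_c|<\infty$, $|\cdot|$ the operator norm. **Schatten classes.** For $p\in[1,\infty)$, $\mathcal S_p(\mathbf H)$ is the set of $\theta\in\mathbf{Hilb}(\mathscr X)(\mathbf H,\mathbf H)$ with $\theta_c$ compact for all $c\in\mathscr X$ and $\sup_{c\in Irr(\mathscr X)}\|\theta_c\|_p<\infty$,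 where $\|T\|_p=(\sum_n s_n(T)^p)^{1/p}$ with $s_n(T)$ the singular values of $T$. For $\theta\in\mathcal S_1(\mathbf H)$, $Trace(\theta):=\sum_{c\in Irr(\mathscr X)}trace(\theta_c)$. **Fredholm modules.** A $p$-summable Fredholm module $(\mathbf H,\mathbf F)$ over an algebra $A$ consists of: a $\mathbb Z_2$-graded object $\mathbf H=\mathbf H^+\oplus\mathbf H^-$ of $\mathbf{Hilb}(\mathscr X)$ with grading operator $\varepsilon$ ($\varepsilon=\pm1$ on $\mathbf H^\pm$); an algebra homomorphism $\rho:A\to\mathbf{Hilb}(\mathscr X)(\mathbf H,\mathbf H)$ of degree zero ($A$ concentrated in degree zero, i.e. each $\rho(a)$ commutes with $\varepsilon$); and $\mathbf F\in\mathbf{Hilb}(\mathscr X)(\mathbf H,\mathbf H)$ with $\mathbf F^2=id$, $\mathbf F\varepsilon=-\varepsilon\mathbf F$, and $\mathbf F\rho(a)-\rho(a)\mathbf F\in\mathcal S_p(\mathbf H)$ for all $a\in A$. **The algebra $\Omega$.** An element $\theta\in\mathbf{Hilb}(\mathscr X)(\mathbf H,\mathbf H)$ is homogeneous of even (resp. odd) degree if it commutes (resp. anticommutes) with $\varepsilon$. The graded commutator is $[\mathbf F,\theta]=\mathbf F\theta-(-1)^{\deg\theta}\theta\mathbf F$ for homogeneous $\theta$, extended linearly, and $d\theta:=i[\mathbf F,\theta]$. Let $\widetilde A=A\oplus\mathbb C$ be $A$ with a unit adjoined, and extend $\rho$ to a unital homomorphism on $\widetilde A$. For $j\ge0$, $\Omega^j\subseteq\mathbf{Hilb}(\mathscr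 X)(\mathbf H,\mathbf H)$ is the linear span of the elements $\rho(a_0)d\rho(a_1)\cdots d\rho(a_j)$, $a_0,\dots,a_j\in\widetilde A$. Then $(\Omega:=\bigoplus_{j\ge0}\Omega^j,d)$ is a differential graded algebra under composition. **Closed graded trace.** A closed graded trace of dimension $n$ on $(\Omega,d)$ is a linear map $\int:\Omega^n\to\mathbb C$ such that $\int d\omega=0$ for all $\omega\in\Omega^{n-1}$, and $\int\omega_1\omega_2=(-1)^{ij}\int\omega_2\omega_1$ for all $\omega_1\in\Omega^i$, $\omega_2\in\Omega^j$ with $i,j\ge0$, $i+j=n$. *)

(* Defs.v *)
From HB Require Import structures.
From mathcomp Require Import all_boot all_order all_algebra.
From mathcomp Require Import all_classical all_reals all_analysis.
From mathcomp Require Import complex.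
Set Implicit Arguments. Unset Strict Implicit. Unset Printing Implicit Defensive.
Import Order.TTheory GRing.Theory Num.Theory.
Import numFieldNormedType.Exports.
Local Open Scope classical_set_scope.
Local Open Scope ring_scope.
Local Open Scope complex_scope.
Section Hilbert.
Variable R : realType.

Record hilbert := Hilbert {
  hilb_car :> completeNormedModType R[i];
  hip : {dot hilb_car for Num.conj};
  hipE : forall x, hip x x = `|x| ^+ 2;
  hilb_separable : exists2 D : set hilb_car, countable D & dense D }.
End Hilbert.
Arguments hip {R h}.

Section DirectSum.
Variables (R : realType) (H K : hilbert R).
Local Notation C := R[i].

(* An alias of H * K, whose default norm is the maximum of the two norms
   instead of the Hilbert space norm. *)
Definition hsum := (H * K)%type.
HB.instance Definition _ := GRing.Lmodule.copy hsum (H * K)%type.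

Definition hsum_norm (x : hsum) : C := sqrtC (`|x.1| ^+ 2 + `|x.2| ^+ 2).

Lemma hsum_normE x : hsum_norm x = `| `|x.1| + 'i * `|x.2| |.
Proof. by rewrite normC_rect ?normr_real. Qed.

Lemma hsum_normD x y : hsum_norm (x + y) <= hsum_norm x + hsum_norm y.
Proof.
apply: (@le_trans _ _ `|( `|x.1| + 'i * `|x.2|) + ( `|y.1| + 'i * `|y.2|)|);
  last by rewrite !hsum_normE ler_normD.
rewrite /hsum_norm addrACA -mulrDr normC_rect ?rpredD ?normr_real//.
rewrite ler_sqrtC ?nnegrE ?addr_ge0 ?exprn_ge0// ?addr_ge0//.
by rewrite lerD// lerXn2r ?nnegrE ?addr_ge0//= ler_normD.
Qed.

Lemma hsum_normZ (l : C) x : hsum_norm (l *: x) = `|l| * hsum_norm x.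
Proof.
rewrite /hsum_norm/= !normrZ !exprMn -mulrDr sqrtCM ?nnegrE ?addr_ge0 ?exprn_ge0//.
by rewrite sqrCK.
Qed.

Lemma hsum_norm0_eq0 x : hsum_norm x = 0 -> x = 0.
Proof.
rewrite /hsum_norm => /eqP; rewrite sqrtC_eq0 paddr_eq0 ?exprn_ge0//.
rewrite !sqrf_eq0 !normr_eq0 => /andP[/eqP x1 /eqP x2].
by case: x x1 x2 => /= ? ? -> ->.
Qed.

HB.instance Definition _ := Lmodule_isNormed.Build C hsum
  hsum_normD hsum_normZ hsum_norm0_eq0.

Lemma norm_hsumE (x : hsum) : `|x| = sqrtC (`|x.1| ^+ 2 + `|x.2| ^+ 2).
Proof. by []. Qed.

Lemma norm_hsum_fst (x : hsum) : `|x.1| <= `|x|.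
Proof.
rewrite norm_hsumE -[leLHS]sqrCK// ler_sqrtC ?nnegrE ?addr_ge0 ?exprn_ge0//.
by rewrite lerDl exprn_ge0.
Qed.

Lemma norm_hsum_snd (x : hsum) : `|x.2| <= `|x|.
Proof.
rewrite norm_hsumE -[leLHS]sqrCK// ler_sqrtC ?nnegrE ?addr_ge0 ?exprn_ge0//.
by rewrite lerDr exprn_ge0.
Qed.

Lemma norm_hsum_le (x : hsum) : `|x| <= `|x.1| + `|x.2|.
Proof.
rewrite norm_hsumE -[leRHS]sqrCK ?addr_ge0//.
rewrite ler_sqrtC ?nnegrE ?addr_ge0 ?exprn_ge0 ?addr_ge0//.
by rewrite sqrrD lerD2r lerDl mulrn_wge0// mulr_ge0.
Qed.



Lemma cauchy_nonexpansive (V : normedModType C) (f : hsum -> V) (F : set_system hsum) :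
  (forall x y, `|f x - f y| <= `|x - y|) -> ProperFilter F -> cauchy F -> cauchy (f @ F).
Proof.
move=> fF FF /cauchy_ballP cF; apply/cauchy_ballP => e e0.
have [[P Q] /= [FP FQ] PQ] := cF _ e0.
exists (f @` P, f @` Q) => /=.
  by split; [apply: filterS FP|apply: filterS FQ] => x Px; exists x.
move=> [_ _] /= [[x Px <-] [y Qy <-]].
have := PQ (x, y) (conj Px Qy); rewrite /= -!ball_normE /=.
exact: le_lt_trans.
Qed.

Lemma hsum_complete (F : set_system hsum) : ProperFilter F -> cauchy F -> cvg F.
Proof.
move=> FF cF.
have /cauchy_cvg /cvg_ex[/= l1 Fl1] : cauchy ((fun x : hsum => x.1) @ F).
  apply: cauchy_nonexpansive => // x y; exact: (norm_hsum_fst (x - y)).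
have /cauchy_cvg /cvg_ex[/= l2 Fl2] : cauchy ((fun x : hsum => x.2) @ F).
  apply: cauchy_nonexpansive => // x y; exact: (norm_hsum_snd (x - y)).
apply/cvg_ex; exists ((l1, l2) : hsum).
apply/cvgrPdist_lt => e e0; near=> x.
rewrite (le_lt_trans (norm_hsum_le _))// (splitr e) ltrD//=.
  by near: x; move/cvgrPdist_lt : Fl1; apply; rewrite divr_gt0.
by near: x; move/cvgrPdist_lt : Fl2; apply; rewrite divr_gt0.
Unshelve. all: by end_near. Qed.

HB.instance Definition _ := Uniform_isComplete.Build hsum hsum_complete.

Lemma dense_norm (V : normedModType C) (D : set V) :
  dense D <-> forall x e, 0 < e -> exists2 y, D y & `|x - y| < e.
Proof.
split=> [dD x e e0|dD O [x Ox]].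
  have [|y [/interior_subset + Dy]] := dD _ _ (@open_interior _ (ball x e)).
    by exists x; exact: nbhsx_ballx.
  by rewrite -ball_normE /= => xy; exists y.
rewrite openE => /(_ _ Ox); rewrite /interior -nbhs_ballE => -[e /= e0 xeO].
have [y Dy xy] := dD x _ e0.
by exists y; split => //; apply: xeO; rewrite -ball_normE.
Qed.

Lemma hsum_separable : exists2 D : set hsum, countable D & dense D.
Proof.
have [D1 cD1 /dense_norm dD1] := hilb_separable H.
have [D2 cD2 /dense_norm dD2] := hilb_separable K.
exists (D1 `*` D2); first exact: countableX.
apply/dense_norm => x e e0; have e20 : 0 < e / 2 by rewrite divr_gt0.
have [y1 Dy1 xy1] := dD1 x.1 _ e20; have [y2 Dy2 xy2] := dD2 x.2 _ e20.
exists (y1, y2) => //.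
by rewrite (le_lt_trans (norm_hsum_le _))// (splitr e) ltrD.
Qed.
Definition hsum_ip (x y : hsum) : C := hip x.1 y.1 + hip x.2 y.2.
Lemma hsum_ipE x : hsum_ip x x = `|x| ^+ 2.
Proof. by rewrite /hsum_ip norm_hsumE sqrtCK !hipE. Qed.

Lemma hsum_bilinear : bilinear_for *%R (Num.conj \; *%R) hsum_ip.
Proof.
split => u a x y; rewrite /hsum_ip /=.
  by rewrite !linearPl mulrDr addrACA.
by rewrite !linearPr mulrDr addrACA.
Qed.
Lemma hsum_hermitian (x y : hsum) :
  hsum_ip x y = (-1) ^+ false * Num.conj (hsum_ip y x).
Proof. by rewrite /hsum_ip rmorphD mul1r hermC [X in _ + X]hermC !mul1r. Qed.
Lemma hsum_posdef (x : hsum) : x != 0 -> 0 < hsum_ip x x.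
Proof. by move=> x0; rewrite hsum_ipE exprn_gt0// normr_gt0. Qed.
HB.instance Definition _ := bilinear_isBilinear.Build C hsum hsum C
  *%R (Num.conj \; *%R) hsum_ip hsum_bilinear.
HB.instance Definition _ := isHermitianSesquilinear.Build C hsum false Num.conj
  hsum_ip hsum_hermitian.
HB.instance Definition _ := isDotProduct.Build C hsum hsum_ip hsum_posdef.

Definition hdsum : hilbert R := @Hilbert R hsum hsum_ip hsum_ipE hsum_separable.
End DirectSum.

Section Operators.
Variable R : realType.
Implicit Types H K : hilbert R.

Definition hnorm H (x : H) : R := complex.Re `|x|.

Lemma hnormE H (x : H) : `|x| = (hnorm x)%:C%C.
Proof. by rewrite /hnorm RRe_real// normr_real. Qed.

Lemma hnorm_ge0 H (x : H) : 0 <= hnorm x.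
Proof. by rewrite -lecR -hnormE normr_ge0. Qed.

Definition opnorm H K (T : H -> K) : \bar R :=
  ereal_sup [set (hnorm (T x))%:E | x in [set x | hnorm x <= 1]].

Definition uniformly_bounded (I : Type) (H K : I -> hilbert R)
    (T : forall c, H c -> K c) :=
  (ereal_sup (range (fun c => opnorm (@T c))) < +oo)%E.

Lemma uniformly_boundedP (I : Type) (H K : I -> hilbert R)
    (T : forall c, H c -> K c) : (forall c, linear (@T c)) ->
  uniformly_bounded T <->
  exists2 M : R[i], 0 <= M & forall c x, `|T c x| <= M * `|x|.
Proof.
move=> linT; have T0 c : T c 0 = 0.
  have := linT c 1 0 0; rewrite !scale1r addr0.
  by move=> /(congr1 (+%R^~ (- T c 0))); rewrite addrK subrr.
have TZ c a x : T c (a *: x) = a *: T c x.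
  by have := linT c a x 0; rewrite T0 !addr0.
split=> [Tb|[M M0 TM]].
  pose s := maxe 0%E (ereal_sup (range (fun c => opnorm (@T c)))).
  have sfin : s \is a fin_num.
    rewrite fin_numE -ltNye -ltey /s; apply/andP; split.
      by rewrite lt_max ltNy0.
    by rewrite gt_max ltry.
  exists (fine s)%:C%C.
    by rewrite lecR fine_ge0// le_max lexx.
  move=> c x; have [->|x0] := eqVneq x 0; first by rewrite T0 !normr0 mulr0.
  have nx0 : `|x| != 0 by rewrite normr_eq0.
  have : hnorm (T c (`|x|^-1 *: x)) <= fine s.
    rewrite -lee_fin fineK//; apply: (@le_trans _ _ (opnorm (@T c))).
      apply: ereal_sup_ubound => /=; exists (`|x|^-1 *: x) => //=.
      by rewrite -lecR -hnormE normrZ normfV normr_id mulVf.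
    by rewrite le_max; apply/orP; right; apply: ereal_sup_ubound; exists c.
  rewrite -lecR -hnormE TZ normrZ normfV normr_id.
  by rewrite ler_pdivrMl ?normr_gt0// mulrC.
apply: (@le_lt_trans _ _ (complex.Re M)%:E); last by rewrite ltry.
apply: ge_ereal_sup => _ [c _ <-]; apply: ge_ereal_sup => _ [x /= x1 <-].
rewrite lee_fin -lecR -hnormE (le_trans (TM _ _))// RRe_real ?ger0_real//.
by rewrite ler_piMr// hnormE lecR.
Qed.

Definition is_adjoint H K (T : H -> K) (S : K -> H) :=
  forall x y, hip (T x) y = hip x (S y).

Definition compact_op H K (T : H -> K) :=
  compact (closure (T @` [set x | hnorm x <= 1])).

(* Eigenvalues of |T| = (T^* T)^{1/2} in decreasing order, repeated according
   to multiplicity and numbered from 0: the n-th one is at least l iff T^* T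
   has n + 1 orthonormal eigenvectors with eigenvalues (m i)^2, m i >= l.
   The equation T^* T (e i) = (m i)^2 e i is tested against all vectors y. *)
Definition singular_value H K (T : H -> K) (n : nat) : R :=
  sup [set l | 0 <= l /\ exists (e : 'I_n.+1 -> H) (m : 'I_n.+1 -> R),
    [/\ forall i j, hip (e i) (e j) = (i == j)%:R,
        forall i, l <= m i &
        forall i y, hip (T (e i)) (T y) = hip ((m i ^+ 2)%:C%C *: e i) y]].

Definition schatten_norm (p : R) H K (T : H -> K) : \bar R :=
  ((\sum_(0 <= n <oo) (singular_value T n `^ p)%:E) `^ p^-1)%E.

(* The nonzero e n form an orthonormal basis; null vectors are allowed so that
   finite-dimensional spaces are covered as well. *)
Definition hilbert_basis H (e : nat -> H) :=
  [/\ forall i j, i != j -> hip (e i) (e j) = 0,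
      forall i, e i = 0 \/ hip (e i) (e i) = 1 &
      forall x, (forall i, hip x (e i) = 0) -> x = 0].

(* Summed along one chosen basis: for trace class T the sum does not depend on
   it. *)
Definition trace H (T : H -> H) : R[i] :=
  let e := xget (fun=> 0) (@hilbert_basis H) in
  limn (series (fun n => hip (T (e n)) (e n)) : nat -> R[i]^o).

End Operators.

Section Categories.
Variable R : realType.
Local Notation C := R[i].

Record linear_category := LinearCategory {
  obj :> Type;
  Hom : obj -> obj -> vectType C;
  idm : forall a, Hom a a;
  cmp : forall a b c, {bilinear Hom b c -> Hom a b -> Hom a c};
  cmp1m : forall a b (f : Hom a b), cmp a b b (idm b) f = f;
  cmpm1 : forall a b (f : Hom a b), cmp a a b f (idm a) = f;
  cmpA : forall a b c d (h : Hom c d) (g : Hom b c) (f : Hom a b),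
    cmp a b d (cmp b c d h g) f = cmp a c d h (cmp a b c g f) }.

End Categories.

Arguments Hom {R l}.
Arguments idm {R l}.
Arguments cmp {R l a b c}.
Notation "g \oc f" := (cmp g f) (at level 40, left associativity).

Section Abelian.
Variables (R : realType) (X : linear_category R).
Implicit Types a b c d : X.

Definition invertible a b (f : Hom a b) :=
  exists g : Hom b a, g \oc f = idm a /\ f \oc g = idm b.

Definition isomorphic a b := exists f : Hom a b, invertible f.

Definition monic a b (f : Hom a b) :=
  forall c (g h : Hom c a), f \oc g = f \oc h -> g = h.

Definition epic a b (f : Hom a b) :=
  forall c (g h : Hom b c), g \oc f = h \oc f -> g = h.

Definition zero_object z :=
  forall a, (forall f : Hom a z, f = 0) /\ (forall f : Hom z a, f = 0).

Definition is_biproduct a b s := exists (i1 : Hom a s) (i2 : Hom b s)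
    (p1 : Hom s a) (p2 : Hom s b),
  [/\ p1 \oc i1 = idm a, p2 \oc i2 = idm b, p1 \oc i2 = 0, p2 \oc i1 = 0 &
      i1 \oc p1 + i2 \oc p2 = idm s].

Definition is_kernel a b c (f : Hom a b) (k : Hom c a) :=
  f \oc k = 0 /\
  forall d (g : Hom d a), f \oc g = 0 -> exists! h : Hom d c, k \oc h = g.

Definition is_cokernel a b c (f : Hom a b) (k : Hom b c) :=
  k \oc f = 0 /\
  forall d (g : Hom b d), g \oc f = 0 -> exists! h : Hom c d, h \oc k = g.

Definition abelian := [/\ exists z, zero_object z,
  forall a b, exists s, is_biproduct a b s,
  forall a b (f : Hom a b), (exists c (k : Hom c a), is_kernel f k) /\
                            (exists c (k : Hom b c), is_cokernel f k),
  forall a b (k : Hom a b), monic k -> exists c (f : Hom b c), is_kernel f k &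
  forall a b (k : Hom a b), epic k -> exists c (f : Hom c a), is_cokernel f k].

Definition simple a :=
  ~ zero_object a /\
  forall b (f : Hom b a), monic f -> f = 0 \/ invertible f.

Definition is_Irr (I : Type) (irr : I -> X) :=
  [/\ forall i, simple (irr i),
      forall i j, isomorphic (irr i) (irr j) -> i = j &
      forall a, simple a -> exists i, isomorphic a (irr i)].

(* The identity morphism of a = b, with source a and target b: it carries the
   strictness equations between objects over to morphisms. *)
Definition idto a b (e : a = b) : Hom a b :=
  match e in _ = b' return Hom a b' with erefl => idm a end.

End Abelian.

Section TensorCategories.
Variable R : realType.

Record strict_monoidal (X : linear_category R) := StrictMonoidal {
  one_obj : X;
  tens : X -> X -> X;
  tensm : forall a b c d : X,
    {bilinear Hom a b -> Hom c d -> Hom (tens a c) (tens b d)};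
  tensm_id : forall a b, tensm a a b b (idm a) (idm b) = idm (tens a b);
  tensm_cmp : forall a b c a' b' c' (g : Hom b c) (f : Hom a b)
      (g' : Hom b' c') (f' : Hom a' b'),
    tensm a c a' c' (g \oc f) (g' \oc f') =
    tensm b c b' c' g g' \oc tensm a b a' b' f f';
  tensA : forall a b c, tens a (tens b c) = tens (tens a b) c;
  tens1o : forall a, tens one_obj a = a;
  tenso1 : forall a, tens a one_obj = a;
  tensmA : forall a b a' b' a'' b'' (f : Hom a b) (f' : Hom a' b')
      (f'' : Hom a'' b''),
    idto (tensA b b' b'') \oc tensm _ _ _ _ f (tensm _ _ _ _ f' f'') =
    tensm _ _ _ _ (tensm _ _ _ _ f f') f'' \oc idto (tensA a a' a'');
  tensm1o : forall a b (f : Hom a b),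
    idto (tens1o b) \oc tensm _ _ _ _ (idm one_obj) f = f \oc idto (tens1o a);
  tensmo1 : forall a b (f : Hom a b),
    idto (tenso1 b) \oc tensm _ _ _ _ f (idm one_obj) = f \oc idto (tenso1 a) }.

Definition is_dual (X : linear_category R) (M : strict_monoidal X) (a b : X) :=
  exists (ev : Hom (tens M b a) (one_obj M))
         (coev : Hom (one_obj M) (tens M a b)),
  idto (tenso1 M a) \oc tensm M _ _ _ _ (idm a) ev \oc idto (esym (tensA M a b a))
    \oc tensm M _ _ _ _ coev (idm a) \oc idto (esym (tens1o M a)) = idm a /\
  idto (tens1o M b) \oc tensm M _ _ _ _ ev (idm b) \oc idto (tensA M b a b)
    \oc tensm M _ _ _ _ (idm b) coev \oc idto (esym (tenso1 M b)) = idm b.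

Definition rigid (X : linear_category R) (M : strict_monoidal X) :=
  forall a, (exists b, is_dual M a b) /\ (exists b, is_dual M b a).

Record dagger (X : linear_category R) := Dagger {
  dag : forall a b : X, Hom a b -> Hom b a;
  dag_antilinear : forall a b (z : R[i]) (f g : Hom a b),
    dag (z *: f + g) = Num.conj z *: dag f + dag g;
  dagK : forall a b (f : Hom a b), dag (dag f) = f;
  dag_cmp : forall a b c (g : Hom b c) (f : Hom a b),
    dag (g \oc f) = dag f \oc dag g }.

Definition spectrum (X : linear_category R) (a : X) (f : Hom a a) : set R[i] :=
  [set xi | ~ invertible (f - xi *: idm a)].

Definition hom_norm (X : linear_category R) (D : dagger X) (a b : X)
    (f : Hom a b) : R :=
  Num.sqrt (sup [set complex.Re `|xi| | xi in spectrum (dag D f \oc f)]).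

Record Cstar_axioms (X : linear_category R) (D : dagger X) : Prop := CstarAxioms {
  cstar_pos : forall (a b : X) (f : Hom a b), exists g : Hom a a,
    dag D f \oc f = dag D g \oc g;
  hom_norm_eq0 : forall (a b : X) (f : Hom a b), hom_norm D f = 0 -> f = 0;
  hom_normZ : forall (a b : X) (z : R[i]) (f : Hom a b),
    hom_norm D (z *: f) = complex.Re `|z| * hom_norm D f;
  hom_normD : forall (a b : X) (f g : Hom a b),
    hom_norm D (f + g) <= hom_norm D f + hom_norm D g;
  hom_normM : forall (a b c : X) (g : Hom b c) (f : Hom a b),
    hom_norm D (g \oc f) <= hom_norm D g * hom_norm D f;
  hom_norm_cstar : forall (a b : X) (f : Hom a b),
    hom_norm D (dag D f \oc f) = hom_norm D f ^+ 2;
  hom_norm_complete : forall (a b : X) (u : nat -> Hom a b),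
    (forall e : R, 0 < e -> exists N, forall m n, (N <= m)%N -> (N <= n)%N ->
       hom_norm D (u m - u n) < e) ->
    exists l, forall e : R, 0 < e -> exists N, forall n, (N <= n)%N ->
      hom_norm D (u n - l) < e }.

Record rigid_Cstar_tensor_category := RigidCstarTensorCategory {
  rct_category :> linear_category R;
  rct_abelian : abelian rct_category;
  rct_tensor : strict_monoidal rct_category;
  rct_dagger : dagger rct_category;
  rct_dag_tensor : forall (a b c d : rct_category) (g : Hom a b) (f : Hom c d),
    dag rct_dagger (tensm rct_tensor a b c d g f) =
    tensm rct_tensor b a d c (dag rct_dagger g) (dag rct_dagger f);
  rct_Cstar : Cstar_axioms rct_dagger;
  rct_rigid : rigid rct_tensor;
  rct_simple1 : simple (one_obj rct_tensor) }.

End TensorCategories.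

Section HilbX.
Variables (R : realType) (X : rigid_Cstar_tensor_category R).
Local Notation C := R[i].

Record hilbX := HilbX {
  hobj :> X -> hilbert R;
  hmap : forall a b : X, Hom a b -> hobj b -> hobj a;
  hmap_linear : forall (a b : X) (f : Hom a b), linear (hmap f);
  hmap_bounded : forall (a b : X) (f : Hom a b), (opnorm (hmap f) < +oo)%E;
  hmapP : forall (a b : X) (z : C) (f g : Hom a b) x,
    hmap (z *: f + g) x = z *: hmap f x + hmap g x;
  hmap_id : forall (a : X) x, hmap (idm a) x = x;
  hmap_cmp : forall (a b c : X) (g : Hom b c) (f : Hom a b) x,
    hmap (g \oc f) x = hmap f (hmap g x);
  hmap_dag : forall (a b : X) (f : Hom a b),
    is_adjoint (hmap f) (hmap (dag (rct_dagger X) f)) }.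

Arguments hmap h {a b} f x.

Record hilbX_hom (H K : hilbX) := HilbXHom {
  nt :> forall c : X, H c -> K c;
  nt_linear : forall c : X, linear (@nt c);
  nt_natural : forall (a b : X) (f : Hom a b) (x : H b),
    nt (hmap H f x) = hmap K f (nt x);
  nt_bounded : uniformly_bounded nt }.
Arguments nt {H K} _ c x.

HB.instance Definition _ (H K : hilbX) (th : hilbX_hom H K) (c : X) :=
  GRing.isLinear.Build C (H c) (K c) *:%R (nt th c) (@nt_linear H K th c).
HB.instance Definition _ (H : hilbX) (a b : X) (f : Hom a b) :=
  GRing.isLinear.Build C (H b) (H a) *:%R (hmap H f) (@hmap_linear H a b f).

Lemma hilbX_homP (H K : hilbX) (s t : hilbX_hom H K) :
  (forall c x, s c x = t c x) -> s = t.
Proof.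
case: s t => [s s1 s2 s3] [t t1 t2 t3] /= st.
have e : s = t by apply/functional_extensionality_dep => c; exact/funext.
by case: t / e t1 t2 t3 st => t1 t2 t3 _; congr HilbXHom; exact: Prop_irrelevance.
Qed.

Lemma nt_boundedP (H K : hilbX) (s : hilbX_hom H K) :
  exists2 M : C, 0 <= M & forall c x, `|s c x| <= M * `|x|.
Proof. exact/(uniformly_boundedP (@nt_linear _ _ s))/nt_bounded. Qed.

Section HomSpace.
Variables H K : hilbX.
Implicit Types s t : hilbX_hom H K.

Fact hom0_subproof : uniformly_bounded (fun c (x : H c) => 0 : K c).
Proof.
apply/uniformly_boundedP; first by move=> c a x y; rewrite scaler0 addr0.
by exists 0 => // c x; rewrite normr0 mul0r.
Qed.
Definition hom0 : hilbX_hom H K.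
Proof.
apply: (@HilbXHom _ _ (fun c x => 0)) hom0_subproof => [c a x y|a b f x].
  by rewrite scaler0 addr0.
by rewrite raddf0.
Defined.

Fact homZD_linear (z : C) s t c : linear (fun x => z *: s c x + t c x).
Proof.
move=> a x y; rewrite (linearP (s c)) (linearP (t c)) /= !scalerDr !scalerA [z * a]mulrC.
by rewrite addrACA.
Qed.
Fact homZD_bounded (z : C) s t : uniformly_bounded (fun c x => z *: s c x + t c x).
Proof.
apply/uniformly_boundedP; first exact: homZD_linear.
have [M M0 sM] := nt_boundedP s; have [N N0 tN] := nt_boundedP t.
exists (`|z| * M + N) => [|c x]; first by rewrite addr_ge0// mulr_ge0.
by rewrite (le_trans (ler_normD _ _))// mulrDl lerD ?tN// normrZ -mulrA ler_wpM2l ?sM.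
Qed.
Fact homZD_natural (z : C) s t (a b : X) (f : Hom a b) x :
  z *: s a (hmap H f x) + t a (hmap H f x) = hmap K f (z *: s b x + t b x).
Proof. by rewrite !nt_natural (linearP (hmap K f)). Qed.
Definition homZD (z : C) s t : hilbX_hom H K :=
  HilbXHom (homZD_linear z s t) (homZD_natural z s t) (homZD_bounded z s t).

HB.instance Definition _ := gen_eqMixin (hilbX_hom H K).
HB.instance Definition _ := gen_choiceMixin (hilbX_hom H K).

Fact homA : associative (homZD 1).
Proof. by move=> s t u; apply: hilbX_homP => c x /=; rewrite !scale1r addrA. Qed.
Fact homC : commutative (homZD 1).
Proof. by move=> s t; apply: hilbX_homP => c x /=; rewrite !scale1r addrC. Qed.
Fact hom0l : left_id hom0 (homZD 1).
Proof. by move=> s; apply: hilbX_homP => c x /=; rewrite scaler0 add0r. Qed.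
Fact homNl : left_inverse hom0 (fun s => homZD (-1) s hom0) (homZD 1).
Proof.
by move=> s; apply: hilbX_homP => c x /=; rewrite addr0 scaleN1r scale1r addNr.
Qed.
HB.instance Definition _ := GRing.isZmodule.Build (hilbX_hom H K) homA homC hom0l homNl.

Lemma homDE s t c x : (s + t) c x = s c x + t c x.
Proof. by rewrite [LHS]/= scale1r. Qed.

Definition homZ (z : C) s := homZD z s hom0.
Fact homZE z s c x : homZ z s c x = z *: s c x.
Proof. by rewrite [LHS]/= addr0. Qed.
Fact homZA a b s : homZ a (homZ b s) = homZ (a * b) s.
Proof. by apply: hilbX_homP => c x; rewrite !homZE scalerA. Qed.
Fact hom1Z : left_id 1 homZ.
Proof. by move=> s; apply: hilbX_homP => c x; rewrite homZE scale1r. Qed.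
Fact homZDr : right_distributive homZ +%R.
Proof. by move=> z s t; apply: hilbX_homP => c x; rewrite !(homZE, homDE) scalerDr. Qed.
Fact homZDl s : {morph homZ^~ s : a b / a + b}.
Proof. by move=> a b; apply: hilbX_homP => c x; rewrite !(homZE, homDE) scalerDl. Qed.
HB.instance Definition _ :=
  GRing.Zmodule_isLmodule.Build C (hilbX_hom H K) homZA hom1Z homZDr homZDl.

Lemma homscaleE (z : C) s c x : (z *: s) c x = z *: s c x.
Proof. exact: homZE. Qed.
Lemma hom0E c x : (0 : hilbX_hom H K) c x = 0.
Proof. by []. Qed.
Lemma homNE s c x : (- s) c x = - s c x.
Proof. by rewrite [LHS]/= addr0 scaleN1r. Qed.

End HomSpace.

Section Composition.
Variables H K L : hilbX.

Fact homM_linear (t : hilbX_hom K L) (s : hilbX_hom H K) c :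
  linear (fun x => t c (s c x)).
Proof. by move=> a x y; rewrite (linearP (s c)) (linearP (t c)). Qed.
Fact homM_bounded (t : hilbX_hom K L) (s : hilbX_hom H K) :
  uniformly_bounded (fun c x => t c (s c x)).
Proof.
apply/uniformly_boundedP; first exact: homM_linear.
have [M M0 sM] := nt_boundedP s; have [N N0 tN] := nt_boundedP t.
exists (N * M) => [|c x]; first by rewrite mulr_ge0.
by rewrite (le_trans (tN _ _))// -mulrA ler_wpM2l ?sM.
Qed.
Fact homM_natural (t : hilbX_hom K L) (s : hilbX_hom H K) (a b : X)
    (f : Hom a b) x : t a (s a (hmap H f x)) = hmap L f (t b (s b x)).
Proof. by rewrite !nt_natural. Qed.
Definition homM (t : hilbX_hom K L) (s : hilbX_hom H K) : hilbX_hom H L :=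
  HilbXHom (homM_linear t s) (homM_natural t s) (homM_bounded t s).

End Composition.

Section Endomorphisms.
Variable H : hilbX.
Local Notation E := (hilbX_hom H H).

Fact hom1_linear c : linear (fun x : H c => x). Proof. by []. Qed.
Fact hom1_bounded : uniformly_bounded (fun c (x : H c) => x).
Proof.
by apply/uniformly_boundedP => //; exists 1 => // c x; rewrite mul1r.
Qed.
Definition hom1 : E := HilbXHom hom1_linear (fun _ _ _ _ => erefl) hom1_bounded.

Fact homMA : associative (@homM H H H). Proof. by move=> s t u; exact: hilbX_homP. Qed.
Fact homM1 : left_id hom1 (@homM H H H). Proof. by move=> s; exact: hilbX_homP. Qed.
Fact hom1M : right_id hom1 (@homM H H H). Proof. by move=> s; exact: hilbX_homP. Qed.
Fact homMDl : left_distributive (@homM H H H) +%R.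
Proof. by move=> s t u; apply: hilbX_homP => c x; rewrite /= !scale1r. Qed.
Fact homMDr : right_distributive (@homM H H H) +%R.
Proof.
by move=> s t u; apply: hilbX_homP => c x; rewrite /= !scale1r raddfD.
Qed.
HB.instance Definition _ :=
  GRing.Zmodule_isPzRing.Build E homMA homM1 hom1M homMDl homMDr.

Lemma homME (s t : E) c x : (s * t) c x = s c (t c x). Proof. by []. Qed.
Lemma hom1E c x : (1 : E) c x = x. Proof. by []. Qed.
Lemma homscaleAl (z : C) (s t : E) : z *: (s * t) = (z *: s) * t.
Proof. by apply: hilbX_homP => c x; rewrite !(homscaleE, homME). Qed.
Lemma homscaleAr (z : C) (s t : E) : z *: (s * t) = s * (z *: t).
Proof. by apply: hilbX_homP => c x; rewrite !(homscaleE, homME) linearZ. Qed.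

End Endomorphisms.

Section Sum.
Variables Hp Hm : hilbX.

Let sobj (c : X) : hilbert R := hdsum (Hp c) (Hm c).
Let smap (a b : X) (f : Hom a b) (x : sobj b) : sobj a :=
  (hmap Hp f x.1, hmap Hm f x.2).

Fact smap_linear (a b : X) (f : Hom a b) : linear (smap f).
Proof. by move=> z x y; rewrite /smap /= (linearP (hmap Hp f)) (linearP (hmap Hm f)). Qed.
Fact smap_bounded (a b : X) (f : Hom a b) : (opnorm (smap f) < +oo)%E.
Proof.
have bd (H : hilbX) : exists2 M : C, 0 <= M & forall x, `|hmap H f x| <= M * `|x|.
  have := @uniformly_boundedP R unit (fun=> H b) (fun=> H a) (fun=> hmap H f).
  move=> P; have {P} [|+ _] := P; first by move=> _; exact: hmap_linear.
  case=> [|M M0 HM]; last by exists M => // x; exact: HM tt x.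
  rewrite /uniformly_bounded (_ : range _ = [set opnorm (hmap H f)]).
    by rewrite ereal_sup1 hmap_bounded.
  by apply/seteqP; split=> [_ [_ _ <-]|_ ->] //=; exists tt.
have [M M0 HM] := bd Hp; have [N N0 HN] := bd Hm.
have := @uniformly_boundedP R unit (fun=> sobj b) (fun=> sobj a) (fun=> smap f).
move=> P; have {P} [|_ +] := P; first by move=> _; exact: smap_linear.
move=> Q; apply: (le_lt_trans _ (Q _)); first by apply: ereal_sup_ubound; exists tt.
exists (M + N) => [|_ x]; first by rewrite addr_ge0.
rewrite (le_trans (norm_hsum_le _))// mulrDl lerD//.
  by rewrite (le_trans (HM _))// ler_wpM2l// norm_hsum_fst.
by rewrite (le_trans (HN _))// ler_wpM2l// norm_hsum_snd.
Qed.

Definition hilbX_sum : hilbX.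
Proof.
apply: (@HilbX sobj smap smap_linear smap_bounded).
- by move=> a b z f g x; rewrite /smap !hmapP.
- by move=> a [x y]; rewrite /smap !hmap_id.
- by move=> a b c g f x; rewrite /smap !hmap_cmp.
- by move=> a b f x y; rewrite /= /hsum_ip /= !hmap_dag.
Defined.

Let eps (c : X) (x : hilbX_sum c) : hilbX_sum c := (x.1, - x.2).
Fact grading_linear c : linear (@eps c).
Proof.
move=> z x y; rewrite /eps /=.
by congr pair => /=; rewrite opprD scalerN.
Qed.
Fact grading_natural (a b : X) (f : Hom a b) x :
  eps (hmap hilbX_sum f x) = hmap hilbX_sum f (eps x).
Proof. by rewrite /eps /= /smap /= raddfN. Qed.
Fact grading_bounded : uniformly_bounded eps.
Proof.
apply/uniformly_boundedP; first exact: grading_linear.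
by exists 1 => // c x; rewrite mul1r !norm_hsumE /= normrN.
Qed.

Definition grading : hilbX_hom hilbX_sum hilbX_sum :=
  HilbXHom grading_linear grading_natural grading_bounded.

Lemma grading_sqr : grading * grading = 1.
Proof. by apply: hilbX_homP => c [x y]; rewrite homME /= /eps /= opprK. Qed.

End Sum.
End HilbX.

Arguments hmap {R X} h {a b} f x.
Arguments nt {R X H K} _ c x.

Section Schatten.
Variables (R : realType) (X : rigid_Cstar_tensor_category R).
Variables (H : hilbX X).
Local Notation E := (hilbX_hom H H).

Definition schatten (I : Type) (irr : I -> X) (p : R) : set E :=
  [set th | (forall c, compact_op (th c)) /\
     (ereal_sup (range (fun i => schatten_norm p (th (irr i)))) < +oo)%E].

Definition Trace (I : finType) (irr : I -> X) (th : E) : R[i] :=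
  \sum_(i : I) trace (th (irr i)).

End Schatten.

Section GradedCommutator.
Variables (R : realType) (X : rigid_Cstar_tensor_category R).
Variables (H : hilbX X) (eps F : hilbX_hom H H).
Local Notation C := R[i].
Local Notation E := (hilbX_hom H H).
Implicit Types th : E.

Definition even_deg th := eps * th = th * eps.
Definition odd_deg th := eps * th = - (th * eps).

Definition even_part th : E := 2^-1 *: (th + eps * th * eps).
Definition odd_part th : E := 2^-1 *: (th - eps * th * eps).

(* F has odd degree: a commutator on even elements, an anticommutator on odd
   ones. *)
Definition gcomm th : E :=
  (F * even_part th - even_part th * F) + (F * odd_part th + odd_part th * F).

Definition gdiff th : E := 'i%C *: gcomm th.

Lemma gcommE th : gcomm th = F * th - eps * th * eps * F.
Proof.
have -> : gcomm th = F * (even_part th + odd_part th) -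
                     (even_part th - odd_part th) * F.
  by rewrite /gcomm mulrDr mulrBl opprB addrACA [- _ + _]addrC.
have half (u : E) : 2^-1 *: (u + u) = u.
  by rewrite -mulr2n -[u *+ 2]scaler_nat scalerA mulVf ?scale1r// pnatr_eq0.
congr (F * _ - _ * F).
  by rewrite -scalerDr addrACA subrr addr0 half.
by rewrite -scalerBr opprB addrC addrA subrK half.
Qed.

Hypothesis eps2 : eps * eps = 1.

Lemma gcomm_even th : even_deg th -> gcomm th = F * th - th * F.
Proof. by rewrite gcommE => ->; rewrite -(mulrA th) eps2 mulr1. Qed.

Lemma gcomm_odd th : odd_deg th -> gcomm th = F * th + th * F.
Proof. by rewrite gcommE => ->; rewrite mulNr -(mulrA th) eps2 mulr1 mulNr opprK. Qed.

Lemma gdiffP (z : C) s t : gdiff (z *: s + t) = z *: gdiff s + gdiff t.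
Proof.
rewrite /gdiff !gcommE !(mulrDr, mulrDl) -!(homscaleAr, homscaleAl).
rewrite opprD addrACA -scalerBr scalerDr !scalerA; congr (_ *: _ + _).
by rewrite mulrC.
Qed.

Lemma gdiffM s t : gdiff (s * t) = gdiff s * t + eps * s * eps * gdiff t.
Proof.
rewrite /gdiff !gcommE -homscaleAl -homscaleAr -scalerDr; congr (_ *: _).
rewrite mulrBl mulrBr !mulrA addrA subrK.
by rewrite -[eps * s * eps * eps]mulrA eps2 mulr1.
Qed.

Hypotheses (F2 : F * F = 1) (Feps : F * eps = - (eps * F)).

Lemma gdiff_odd s : eps * gdiff s * eps = gdiff (- (eps * s * eps)).
Proof.
rewrite /gdiff -homscaleAr -homscaleAl; congr (_ *: _); rewrite !gcommE.
have Feps' : eps * F = - (F * eps) by rewrite Feps opprK.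
have efe : eps * F * eps = - F by rewrite Feps' mulNr -mulrA eps2 mulr1.
transitivity (eps * F * s * eps - eps * eps * s * (eps * F * eps)).
  by rewrite mulrBr mulrBl !mulrA.
transitivity (- (F * (eps * s * eps)) + eps * eps * s * (eps * eps) * F).
  by rewrite efe Feps' eps2 !mul1r mulr1 mulrN opprK !mulNr !mulrA.
by rewrite !(mulrN, mulNr) opprK !mulrA.
Qed.

Lemma gdiff_gdiff s : gdiff (gdiff s) = 0.
Proof.
rewrite {1}/gdiff gcommE gdiff_odd {1}/gdiff -homscaleAr.
have -> : gdiff (- (eps * s * eps)) * F = 'i%C *: (F * gcomm s).
  rewrite /gdiff -homscaleAl; congr (_ *: _); rewrite !gcommE.
  rewrite mulrBl mulrBr !mulrA F2 mul1r -[X in _ - X]mulrA F2 mulr1.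
  rewrite !(mulrN, mulNr) opprK !mulrA eps2 mul1r.
  by rewrite -[s * eps * eps]mulrA eps2 mulr1 addrC.
by rewrite subrr scaler0.
Qed.

End GradedCommutator.

Section LinearSpan.
Variables (R : realType) (V : lmodType R[i]).
Implicit Types (S : set V) (P : V -> Prop).

Definition lspan S : set V := [set v | exists2 s : seq (R[i] * V),
  (forall x, x \in s -> S x.2) & v = \sum_(x <- s) x.1 *: x.2].

Lemma lspan_sub S : S `<=` lspan S.
Proof.
move=> v Sv; exists [:: (1, v)]; first by move=> x; rewrite inE => /eqP ->.
by rewrite big_seq1 scale1r.
Qed.

Lemma lspan0 S : lspan S 0.
Proof. by exists [::] => //; rewrite big_nil. Qed.

Lemma lspanP S (z : R[i]) u v : lspan S u -> lspan S v -> lspan S (z *: u + v).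
Proof.
move=> [s Ss ->] [t St ->].
exists ([seq (z * x.1, x.2) | x <- s] ++ t) => [x|].
  by rewrite mem_cat => /orP[/mapP[y /Ss Sy ->]//|/St].
rewrite big_cat big_map scaler_sumr; congr (_ + _).
by apply: eq_bigr => x _; rewrite scalerA.
Qed.

Lemma lspan_ind S P : P 0 -> (forall z u v, P u -> P v -> P (z *: u + v)) ->
  (forall v, S v -> P v) -> forall v, lspan S v -> P v.
Proof.
move=> P0 PP PS v [s Ss ->]; elim: s Ss => [_|x s IH Ss]; first by rewrite big_nil.
rewrite big_cons; apply: PP; first by apply/PS/Ss; rewrite mem_head.
by apply: IH => y ys; apply: Ss; rewrite inE ys orbT.
Qed.

End LinearSpan.

Section Algebras.
Variable R : realType.
Local Notation C := R[i].

(* Associative algebras, not assumed to be unital. *)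
Record assoc_algebra := AssocAlgebra {
  alg_car :> lmodType C;
  amul : {bilinear alg_car -> alg_car -> alg_car};
  amulA : associative amul }.

Variable A : assoc_algebra.

Definition unitization_car := (A * C^o)%type.
HB.instance Definition _ := GRing.Lmodule.copy unitization_car (A * C^o)%type.

Definition unitization_mul (a b : unitization_car) : unitization_car :=
  (amul _ a.1 b.1 + (a.2 : C) *: b.1 + (b.2 : C) *: a.1, (a.2 : C) * b.2).

Fact unitization_bilinear : bilinear_for *:%R *:%R unitization_mul.
Proof.
have AC5 (V : zmodType) (t u v w x : V) :
    t + (u + (v + (w + x))) = u + (w + (t + (v + x))).
  by rewrite addrCA [in RHS](addrCA w) (addrCA v).
split=> u z x y; rewrite /unitization_mul; congr pair => /=.
- rewrite linearPl scalerDl !scalerDr !scalerA [_ * z]mulrC -!addrA.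
  by congr (_ + _); exact: AC5.
- by rewrite mulrDl -mulrA.
- rewrite linearPr scalerDl !scalerDr !scalerA [_ * z]mulrC -!addrA.
  by congr (_ + _); exact: AC5.
- by rewrite mulrDr mulrCA.
Qed.
HB.instance Definition _ := bilinear_isBilinear.Build C
  unitization_car unitization_car unitization_car *:%R *:%R
  unitization_mul unitization_bilinear.

Fact unitization_mulA : associative unitization_mul.
Proof.
move=> [a x] [b y] [c z]; rewrite /unitization_mul; congr pair => /=; last first.
  by rewrite mulrA.
rewrite !(linearDl, linearDr, linearZl_LR, linearZr_LR) /= amulA !scalerDr !scalerA.
rewrite [z * x]mulrC [z * y]mulrC -!addrA; congr (_ + _).
by rewrite [in RHS]addrCA; congr (_ + _); rewrite addrCA; congr (_ + _); rewrite addrCA.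
Qed.

Definition unitization : assoc_algebra := @AssocAlgebra
  unitization_car unitization_mul unitization_mulA.
Definition unitization_one : unitization := ((0 : A), (1 : C)).

End Algebras.

Section DGA.
Variables (R : realType) (X : rigid_Cstar_tensor_category R) (H : hilbX X).
Local Notation C := R[i].
Local Notation E := (hilbX_hom H H).

(* Differential graded algebras \bigoplus_j W j whose homogeneous components
   are subspaces of the algebra of endomorphisms of H, with the composition as
   product. *)
Record dga := Dga {
  dga_deg :> nat -> set E;
  dga_d : E -> E;
  dga_deg0 : forall j, dga_deg j 0;
  dga_degP : forall j (z : C) s t,
    dga_deg j s -> dga_deg j t -> dga_deg j (z *: s + t);
  dga_deg1 : dga_deg 0 1;
  dga_degM : forall i j s t, dga_deg i s -> dga_deg j t -> dga_deg (i + j) (s * t);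
  dga_d_deg : forall j s, dga_deg j s -> dga_deg j.+1 (dga_d s);
  dga_dP : forall j (z : C) s t, dga_deg j s -> dga_deg j t ->
    dga_d (z *: s + t) = z *: dga_d s + dga_d t;
  dga_dM : forall i j s t, dga_deg i s -> dga_deg j t ->
    dga_d (s * t) = dga_d s * t + (-1) ^+ i *: (s * dga_d t);
  dga_dd : forall j s, dga_deg j s -> dga_d (dga_d s) = 0 }.

(* Only the values of T on W n matter. In degree n = 0 the first closedness
   condition is void, as there are no elements of degree -1. *)
Definition closed_graded_trace (W : dga) (n : nat) (T : E -> C) :=
  [/\ forall (z : C) s t, W n s -> W n t -> T (z *: s + t) = z * T s + T t,
      forall j s, j.+1 = n -> W j s -> T (dga_d W s) = 0 &
      forall i j s t, (i + j)%N = n -> W i s -> W j t ->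
        T (s * t) = (-1) ^+ (i * j) * T (t * s)].

End DGA.

Section Fredholm.
Variables (R : realType) (X : rigid_Cstar_tensor_category R).
Local Notation C := R[i].

Record fredholm_module (I : Type) (irr : I -> X) (A : assoc_algebra R) (p : R) :=
  FredholmModule {
  fm_pos : hilbX X;
  fm_neg : hilbX X;
  fm_rho : {linear A ->
    hilbX_hom (hilbX_sum fm_pos fm_neg) (hilbX_sum fm_pos fm_neg)};
  fm_rhoM : forall a b, fm_rho (amul A a b) = fm_rho a * fm_rho b;
  fm_rho_even : forall a, even_deg (grading fm_pos fm_neg) (fm_rho a);
  fm_F : hilbX_hom (hilbX_sum fm_pos fm_neg) (hilbX_sum fm_pos fm_neg);
  fm_F2 : fm_F * fm_F = 1;
  fm_Feps : fm_F * grading fm_pos fm_neg = - (grading fm_pos fm_neg * fm_F);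
  fm_summable : forall a, schatten irr p (fm_F * fm_rho a - fm_rho a * fm_F) }.

Section Omega.
Variables (I : Type) (irr : I -> X) (A : assoc_algebra R) (p : R).
Variable M : fredholm_module irr A p.

Definition fm_H := hilbX_sum (fm_pos M) (fm_neg M).
Definition fm_eps : hilbX_hom fm_H fm_H := grading (fm_pos M) (fm_neg M).
Definition fm_gcomm (th : hilbX_hom fm_H fm_H) := gcomm fm_eps (fm_F M) th.
Definition fm_d (th : hilbX_hom fm_H fm_H) := gdiff fm_eps (fm_F M) th.

Definition fm_rho1 (a : unitization A) : hilbX_hom fm_H fm_H :=
  fm_rho M a.1 + (a.2 : C) *: (1 : hilbX_hom fm_H fm_H).

Definition Omega (j : nat) : set (hilbX_hom fm_H fm_H) :=
  lspan [set w | exists (a0 : unitization A) (a : j.-tuple (unitization A)),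
    w = fm_rho1 a0 * \prod_(b <- a) fm_d (fm_rho1 b)].

Local Notation End_H := (hilbX_hom fm_H fm_H).
Implicit Types (s t w : End_H) (a b : unitization A).
Let mon (l : seq (unitization A)) : End_H := \prod_(b <- l) fm_d (fm_rho1 b).
Let conj_eps s : End_H := fm_eps * s * fm_eps.

Lemma fm_eps2 : fm_eps * fm_eps = 1. Proof. exact: grading_sqr. Qed.

Lemma fm_rho1_one : fm_rho1 (unitization_one A) = 1.
Proof. by rewrite /fm_rho1 /= raddf0 add0r scale1r. Qed.

Lemma fm_rho1M a b : fm_rho1 (amul _ a b) = fm_rho1 a * fm_rho1 b.
Proof.
rewrite /fm_rho1 /= !linearD /= fm_rhoM !linearZ /= mulrDl !mulrDr.
rewrite -!homscaleAl -!homscaleAr !mul1r !mulr1 scalerA -!addrA.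
by congr (_ + _); rewrite addrCA.
Qed.

Lemma fm_rho1_even a : even_deg fm_eps (fm_rho1 a).
Proof.
rewrite /even_deg /fm_rho1 mulrDr mulrDl (fm_rho_even M a.1).
by rewrite -homscaleAl -homscaleAr mul1r mulr1.
Qed.

Lemma fm_dP (z : C) s t : fm_d (z *: s + t) = z *: fm_d s + fm_d t.
Proof. exact: gdiffP. Qed.

Lemma fm_d0 : fm_d 0 = 0.
Proof. by have := fm_dP (-1) 0 0; rewrite scaler0 addr0 scaleN1r addNr. Qed.

Lemma fm_dM s t : fm_d (s * t) = fm_d s * t + conj_eps s * fm_d t.
Proof. exact/gdiffM/fm_eps2. Qed.

Lemma fm_dd s : fm_d (fm_d s) = 0.
Proof. exact: (gdiff_gdiff fm_eps2 (fm_F2 M) (fm_Feps M)). Qed.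

Lemma conj_epsM s t : conj_eps (s * t) = conj_eps s * conj_eps t.
Proof.
rewrite /conj_eps !mulrA; congr (_ * _ * _).
by rewrite -!mulrA fm_eps2 mulr1.
Qed.

Lemma conj_epsP (z : C) s t :
  conj_eps (z *: s + t) = z *: conj_eps s + conj_eps t.
Proof. by rewrite /conj_eps mulrDr mulrDl -homscaleAr -homscaleAl. Qed.

Lemma conj_eps_rho1 a : conj_eps (fm_rho1 a) = fm_rho1 a.
Proof. by rewrite /conj_eps fm_rho1_even -mulrA fm_eps2 mulr1. Qed.

Lemma conj_eps_d s : conj_eps (fm_d s) = - fm_d (conj_eps s).
Proof.
rewrite /conj_eps [LHS](gdiff_odd fm_eps2 (fm_Feps M)).
by have := fm_dP (-1) (conj_eps s) 0; rewrite fm_d0 !addr0 !scaleN1r.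
Qed.

Lemma conj_eps_mon l : conj_eps (mon l) = (-1) ^+ size l *: mon l.
Proof.
rewrite /mon; elim: l => [|b l IH].
  by rewrite !big_nil expr0 scale1r /conj_eps mulr1 fm_eps2.
rewrite !big_cons conj_epsM IH conj_eps_d conj_eps_rho1 /= exprS mulN1r.
by rewrite mulNr -homscaleAr scaleNr.
Qed.

Lemma fm_d_mon l : fm_d (mon l) = 0.
Proof.
rewrite /mon; elim: l => [|b l IH].
  by rewrite big_nil /fm_d /gdiff gcommE mulr1 mulr1 fm_eps2 mul1r subrr scaler0.
by rewrite big_cons fm_dM fm_dd IH mul0r mulr0 addr0.
Qed.

Lemma Omega_gen a l : Omega (size l) (fm_rho1 a * mon l).
Proof. by apply: lspan_sub; exists a, (in_tuple l). Qed.

Lemma Omega_ind j (P : End_H -> Prop) : P 0 ->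
  (forall z s t, P s -> P t -> P (z *: s + t)) ->
  (forall a l, size l = j -> P (fm_rho1 a * mon l)) ->
  forall w, Omega j w -> P w.
Proof.
move=> P0 PP Pgen; apply: lspan_ind => // _ [a [l ->]].
by apply: Pgen; rewrite size_tuple.
Qed.

Lemma Omega_rho1 j a w : Omega j w -> Omega j (fm_rho1 a * w).
Proof.
apply: (Omega_ind (P := fun w => Omega j (fm_rho1 a * w))) => [|z s t|b l <-].
- by rewrite mulr0; exact: lspan0.
- by rewrite mulrDr -homscaleAr; exact: lspanP.
- by rewrite mulrA -fm_rho1M; exact: Omega_gen.
Qed.

Lemma Omega_mon j l w : Omega j w -> Omega (j + size l) (w * mon l).
Proof.
apply: (Omega_ind (P := fun w => Omega (j + size l) (w * mon l))) => [|z s t|b k <-].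
- by rewrite mul0r; exact: lspan0.
- by rewrite mulrDl -homscaleAl; exact: lspanP.
- by rewrite -mulrA /mon -big_cat -size_cat; exact: Omega_gen.
Qed.

Lemma Omega_mon_rho1 l a : Omega (size l) (mon l * fm_rho1 a).
Proof.
elim/last_ind: l a => [|l b IH] a.
  rewrite /mon big_nil mul1r -[fm_rho1 a]mulr1.
  by have := Omega_gen a [::]; rewrite /mon big_nil.
have -> : mon (rcons l b) * fm_rho1 a =
    (-1) *: (mon l * fm_rho1 b * mon [:: a]) +
    mon l * fm_rho1 (unitization_one A) * mon [:: amul _ b a].
  rewrite /mon -cats1 big_cat !big_seq1 /= fm_rho1_one mulr1 fm_rho1M fm_dM.
  rewrite conj_eps_rho1; move: (fm_rho1 a) (fm_rho1 b) => ra rb.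
  by rewrite mulrDr scaleN1r !mulrA addrC addrK.
rewrite size_rcons -addn1; apply: lspanP.
  exact: (@Omega_mon _ [:: a] _ (IH b)).
exact: (@Omega_mon _ [:: amul _ b a] _ (IH _)).
Qed.

Lemma OmegaM i j s t : Omega i s -> Omega j t -> Omega (i + j) (s * t).
Proof.
move=> Os Ot; move: t Ot; apply: (Omega_ind (P := fun t => Omega (i + j) (s * t))).
- by rewrite mulr0; exact: lspan0.
- by move=> z t u; rewrite mulrDr -homscaleAr; exact: lspanP.
move=> b l <-; move: s Os.
apply: (Omega_ind (P := fun s => Omega _ (s * (fm_rho1 b * mon l)))) => [|z s t|a k <-].
- by rewrite mul0r; exact: lspan0.
- by rewrite (mulrDl (z *: s)) -homscaleAl; exact: lspanP.
rewrite -mulrA [mon k * _]mulrA; apply: Omega_rho1; apply: Omega_mon.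
exact: Omega_mon_rho1.
Qed.

Lemma Omega_one : Omega 0 1.
Proof.
have := Omega_gen (unitization_one A) [::].
by rewrite fm_rho1_one mul1r /mon big_nil.
Qed.

Lemma Omega_d j s : Omega j s -> Omega j.+1 (fm_d s).
Proof.
apply: (Omega_ind (P := fun s => Omega j.+1 (fm_d s))) => [|z t u|a l <-].
- by rewrite fm_d0; exact: lspan0.
- by rewrite fm_dP; exact: lspanP.
rewrite fm_dM fm_d_mon mulr0 addr0.
have := Omega_gen (unitization_one A) (a :: l).
by rewrite fm_rho1_one mul1r /mon big_cons.
Qed.

Lemma Omega_conj_eps j s : Omega j s -> conj_eps s = (-1) ^+ j *: s.
Proof.
apply: (Omega_ind (P := fun s => conj_eps s = (-1) ^+ j *: s)) => [|z t u et eu|a l <-].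
- by rewrite scaler0 /conj_eps mulr0 mul0r.
- by rewrite conj_epsP et eu scalerDr !scalerA mulrC.
- by rewrite conj_epsM conj_eps_rho1 conj_eps_mon -homscaleAr.
Qed.

Definition Omega_dga : dga fm_H.
Proof.
apply: (@Dga _ _ fm_H Omega fm_d).
- by move=> j; exact: lspan0.
- by move=> j z s t; exact: lspanP.
- exact: Omega_one.
- exact: OmegaM.
- exact: Omega_d.
- by move=> j z s t _ _; exact: fm_dP.
- move=> i j s t /Omega_conj_eps es _.
  by rewrite fm_dM es; congr (_ + _); exact: esym (homscaleAl _ _ _).
- by move=> j s _; exact: fm_dd.
Defined.

End Omega.

Arguments fm_H {I irr A p} M.
Arguments fm_eps {I irr A p} M.
Arguments fm_gcomm {I irr A p} M th.
(* Only meaningful when fm_gcomm M th belongs to the trace class. *)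
Definition Tr_s (I : finType) (irr : I -> X) (A : assoc_algebra R) (p : R)
    (M : fredholm_module irr A p) (th : hilbX_hom (fm_H M) (fm_H M)) : C :=
  2^-1 * Trace irr (fm_eps M * fm_F M * fm_gcomm M th).

End Fredholm.

Arguments fm_H {R X I irr A p} M.
Arguments fm_eps {R X I irr A p} M.
Arguments fm_gcomm {R X I irr A p} M th.
Arguments fm_d {R X I irr A p} M th.
Arguments fm_rho1 {R X I irr A p} M a.
Arguments Omega {R X I irr A p} M j.
Arguments Omega_dga {R X I irr A p} M.
Arguments Tr_s {R X I irr A p} M th.

(* Main.v *)
Require Import Defs.
From HB Require Import structures.
From mathcomp Require Import all_boot all_order all_algebra.
From mathcomp Require Import all_classical all_reals all_analysis.
From mathcomp Require Import complex.
From mathcomp Require Import ring lra.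
Set Implicit Arguments. Unset Strict Implicit. Unset Printing Implicit Defensive.
Import Order.TTheory GRing.Theory Num.Theory.
Import numFieldNormedType.Exports.
Local Open Scope classical_set_scope.
Local Open Scope ring_scope.

(** All of the statement reduces to the theory of compact operators on the Hilbert
    spaces H(c), applied to each of the finitely many simple objects c.

    Singular systems. The norm of a compact operator T is attained on every
    nonzero closed subspace. Choosing greedily unit vectors e_n where |T x| is
    maximal, among those orthogonal to e_0, ..., e_(n-1), gives eigenvectors of
    T^* T ([singular_system_exists]). Hence s_n(T) = |T e_n|, and this is also the
    least bound of T on a subspace of codimension n ([singular_valueE]). The
    latter description is compatible with sums and products:
    s_(2k)(S + T) <= s_k(S) + s_k(T) and s_(2k)(S T) <= s_k(S) s_k(T). As singular
    values decrease, this makes the Schatten classes ideals and yields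
    Hoelder's inequality ([schatten_opM]).

    Traces. A trace class operator is T = sum_k <., e_k> T e_k, an absolutely
    convergent sum of operators of rank one, and dominated convergence gives
    trace T = sum_k <T e_k, e_k> ([trace_nuclear]). It follows that
    trace (S T) = trace (T S) for T trace class and S bounded ([trace_mulC]), and
    by truncation also for T only compact, when S T and T S are both trace class
    ([trace_cyclic]).

    Fredholm modules. An element of Omega^j is a combination of products with j
    factors [F, rho a], hence belongs to the Schatten class of exponent p / j. For
    w in Omega^n, [F, w] is up to a scalar in Omega^(n+1), hence trace class as
    n + 1 >= p. The assertions on odd and on trace class operators are
    [trace_mulC] combined with the commutation relations of F and epsilon. As
    [F, [F, w]] = 0, the form Tr_s is closed, and [F, w] commutes with epsilon F.
    For s in Omega^i and t in Omega^j, [F, s t] = [F, s] t + (-1)^i s [F, t], and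
    the graded trace property follows from the invariance of the trace under
    the exchange of epsilon F s with [F, t], and of epsilon F t with [F, s]. In
    general none of these is trace class, which is why [trace_cyclic] is needed
    ([Trace_gcomm_cyclic], [Tr_s_graded]). *)

(** * Real-valued norms and convergence *)

Section RealNorm.
Variables (R : realType) (V : normedZmodType R[i]).
Local Notation C := R[i].
Implicit Types x y : V.

(** Norms take their values in the complex numbers, whose order is partial;
    estimates are made on their real values. *)
Definition rnorm x : R := complex.Re `|x|.

Lemma rnormE x : `|x| = (rnorm x)%:C%C.
Proof. by rewrite /rnorm RRe_real// normr_real. Qed.

Lemma rnorm_ge0 x : 0 <= rnorm x.
Proof. by rewrite -lecR -rnormE normr_ge0. Qed.

Lemma rnorm0 : rnorm (0 : V) = 0. Proof. by rewrite /rnorm normr0. Qed.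

Lemma rnorm_eq0 x : rnorm x = 0 -> x = 0.
Proof. by move=> x0; apply/eqP; rewrite -normr_eq0 rnormE x0. Qed.

Lemma rnormD x y : rnorm (x + y) <= rnorm x + rnorm y.
Proof. by rewrite -lecR rmorphD /= -!rnormE ler_normD. Qed.

Lemma rnormN x : rnorm (- x) = rnorm x.
Proof. by rewrite /rnorm normrN. Qed.

Lemma rnormB x y : rnorm (x - y) <= rnorm x + rnorm y.
Proof. by rewrite -(rnormN y) rnormD. Qed.

Lemma rnorm_distC x y : rnorm (x - y) = rnorm (y - x).
Proof. by rewrite -rnormN opprB. Qed.

Lemma rnorm_sum (I : Type) (s : seq I) (P : pred I) (f : I -> V) :
  rnorm (\sum_(i <- s | P i) f i) <= \sum_(i <- s | P i) rnorm (f i).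
Proof.
elim/big_ind2 : _ => // [|x a y b xa yb]; first by rewrite rnorm0.
by rewrite (le_trans (rnormD _ _))// lerD.
Qed.

(** Convergence in norm, which also makes sense for the complex numbers seen as
    a plain normed group. *)
Definition tends (u : nat -> V) (l : V) := (rnorm (u n - l) @[n --> \oo] --> (0 : R)).

Lemma tendsP u l : tends u l <->
  forall e : R, 0 < e -> \forall n \near \oo, rnorm (u n - l) < e.
Proof.
split=> [/cvgr0Pnorm_lt h e e0|h].
  apply: filterS (h e e0) => n; by rewrite ger0_norm ?rnorm_ge0.
by apply/cvgr0Pnorm_lt => e e0; apply: filterS (h e e0) => n; rewrite ger0_norm ?rnorm_ge0.
Qed.

Lemma tends_squeeze u l (b : nat -> R) :
  (forall n, rnorm (u n - l) <= b n) -> b @ \oo --> 0 -> tends u l.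
Proof.
move=> ub b0; apply: (@squeeze_cvgr _ _ _ _ (fun=> 0) b) => //; last exact: cvg_cst.
by apply: nearW => n; rewrite rnorm_ge0 ub.
Qed.

Lemma tends_cst l : tends (fun=> l) l.
Proof. by rewrite /tends subrr rnorm0; exact: cvg_cst. Qed.

Lemma tendsD u v l m : tends u l -> tends v m -> tends (fun n => u n + v n) (l + m).
Proof.
move=> ul vm; apply: (@tends_squeeze _ _ (fun n => rnorm (u n - l) + rnorm (v n - m))).
  by move=> n; rewrite opprD addrACA rnormD.
by rewrite -[0 in X in _ --> X]addr0; exact: cvgD.
Qed.

Lemma tends_sum (J : Type) (s : seq J) (u : J -> nat -> V) (l : J -> V) :
  (forall j, tends (u j) (l j)) ->
  tends (fun n => \sum_(j <- s) u j n) (\sum_(j <- s) l j).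
Proof.
move=> ul; elim: s => [|j s IH].
  by rewrite big_nil (_ : (fun=> _) = fun=> 0); [exact: tends_cst|apply: funext => n; rewrite big_nil].
rewrite big_cons (_ : (fun=> _) = fun n => u j n + \sum_(j <- s) u j n).
  exact: tendsD.
by apply: funext => n; rewrite big_cons.
Qed.

Lemma tends_unique u l m : tends u l -> tends u m -> l = m.
Proof.
move=> /tendsP ul /tendsP um; apply/eqP; rewrite -subr_eq0; apply/eqP/rnorm_eq0.
apply/eqP; rewrite eq_le rnorm_ge0 andbT; apply/ler_addgt0Pr => e e0; rewrite add0r.
have e2 : 0 < e / 2 by rewrite divr_gt0.
near \oo => n.
have := rnormB (u n - m) (u n - l); rewrite opprB addrC addrA subrK => /le_trans; apply.
have : rnorm (u n - m) < e / 2 by near: n; exact: um.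
have : rnorm (u n - l) < e / 2 by near: n; exact: ul.
by lra.
Unshelve. all: by end_near. Qed.

Lemma tends_rnorm_le u l (b : R) : tends u l -> (forall n, rnorm (u n) <= b) -> rnorm l <= b.
Proof.
move=> /tendsP ul ub; apply/ler_addgt0Pr => e e0; near \oo => n.
have := rnormB (u n) (u n - l); rewrite opprB addrC subrK => /le_trans; apply.
rewrite lerD// ltW//; near: n; exact: ul.
Unshelve. all: by end_near. Qed.

End RealNorm.

Section BoundedMaps.
Variable R : realType.
Local Notation C := R[i].

Lemma tends_lipschitz (V W : normedZmodType C) (f : V -> W) (M : R) u l :
  (forall x y, rnorm (f x - f y) <= M * rnorm (x - y)) ->
  tends u l -> tends (f \o u) (f l).
Proof.
move=> fM ul; apply: (@tends_squeeze _ _ _ _ (fun n => M * rnorm (u n - l))).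
  by move=> n; exact: fM.
by rewrite -[0 in X in _ --> X](mulr0 M); apply: cvgM => //; exact: cvg_cst.
Qed.

Lemma rnormZ (V : normedModType C) (z : C) (x : V) : rnorm (z *: x) = rnorm z * rnorm x.
Proof. by apply: complexI; rewrite rmorphM /= -!rnormE normrZ. Qed.

Lemma rnormM (z w : C) : rnorm (z * w) = rnorm z * rnorm w.
Proof. by apply: complexI; rewrite rmorphM /= -!rnormE normrM. Qed.

Lemma rnorm_conj (z : C) : rnorm (Num.conj z) = rnorm z.
Proof. by rewrite /rnorm norm_conjC. Qed.

Lemma rnorm_real (x : R) : rnorm (x%:C%C) = `|x|.
Proof.
by apply: complexI; rewrite -rnormE normc_def /= expr0n /= addr0 sqrtr_sqr.
Qed.

Lemma Re_le_rnorm (z : C) : `|complex.Re z| <= rnorm z.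
Proof.
rewrite /rnorm normc_def /= -sqrtr_sqr ler_sqrt ?addr_ge0 ?sqr_ge0//.
by rewrite lerDl sqr_ge0.
Qed.

Lemma Im_le_rnorm (z : C) : `|complex.Im z| <= rnorm z.
Proof.
rewrite /rnorm normc_def /= -sqrtr_sqr ler_sqrt ?addr_ge0 ?sqr_ge0//.
by rewrite lerDr sqr_ge0.
Qed.

Lemma rnorm_le_ReIm (z : C) : rnorm z <= `|complex.Re z| + `|complex.Im z|.
Proof.
rewrite {1}(complexE z); apply: (le_trans (rnormD _ _)); rewrite rnormM !rnorm_real.
suff -> : rnorm 'i%C = 1 :> R by rewrite mul1r.
by rewrite /rnorm normc_def /= expr0n /= add0r expr1n sqrtr1.
Qed.

Definition cauchy_seq (V : normedZmodType C) (u : nat -> V) :=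
  forall e : R, 0 < e -> exists N, forall m n, (N <= m)%N -> (N <= n)%N -> rnorm (u m - u n) < e.

Lemma tends_cvg (V : normedModType C) (u : nat -> V) l : tends u l <-> u @ \oo --> l.
Proof.
split=> [/tendsP h|h].
  apply/cvgrPdist_lt => e e0.
  have eE : e = (complex.Re e)%:C%C by rewrite RRe_real// gtr0_real.
  have e0' : 0 < complex.Re e by rewrite -ltcR -eE.
  by apply: filterS (h _ e0') => n; rewrite rnorm_distC rnormE eE ltcR.
apply/tendsP => e e0; have e0' : 0 < e%:C%C by rewrite ltcR.
by move/cvgrPdist_lt : h => /(_ _ e0'); apply: filterS => n; rewrite rnorm_distC rnormE ltcR.
Qed.

Lemma cauchy_tends (V : completeNormedModType C) (u : nat -> V) :
  cauchy_seq u -> exists l, tends u l.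
Proof.
move=> cu; have /cauchy_cvg/cvg_ex[l ul] : cauchy (u @ \oo).
  apply/cauchy_ballP => e e0.
  have eE : e = (complex.Re e)%:C%C by rewrite RRe_real// gtr0_real.
  have e0' : 0 < complex.Re e by rewrite -ltcR -eE.
  have [N uN] := cu _ e0'.
  exists (u @` [set n | (N <= n)%N], u @` [set n | (N <= n)%N]).
    by split; exists N => // n /= Nn; exists n.
  move=> [_ _] /= [[m Nm <-] [n Nn <-]]; rewrite -ball_normE /= rnormE eE ltcR.
  exact: uN.
by exists l; exact/tends_cvg.
Qed.

Lemma cauchy_tendsR (u : nat -> R) :
  (forall e : R, 0 < e -> exists N, forall m n, (N <= m)%N -> (N <= n)%N -> `|u m - u n| < e) ->
  exists l : R, u @ \oo --> l.
Proof.
move=> cu; have /cauchy_cvg/cvg_ex[l ul] : cauchy (u @ \oo).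
  apply/cauchy_ballP => e e0.
  have [N uN] := cu _ e0.
  exists (u @` [set n | (N <= n)%N], u @` [set n | (N <= n)%N]).
    by split; exists N => // n /= Nn; exists n.
  move=> [_ _] /= [[m Nm <-] [n Nn <-]]; rewrite -ball_normE /=.
  exact: uN.
by exists l.
Qed.

(** Completeness of the complex numbers follows from that of the reals, applied
    to real and imaginary parts. *)
Lemma cauchy_tendsC (u : nat -> C) : cauchy_seq u -> exists l, tends u l.
Proof.
move=> cu.
have [|a ua] := @cauchy_tendsR (fun n => complex.Re (u n)).
  move=> e /cu [N h]; exists N => m n Nm Nn; apply: le_lt_trans (h _ _ Nm Nn).
  by apply: le_trans (Re_le_rnorm _); case: (u m) (u n) => [? ?] [? ?].
have [|b ub] := @cauchy_tendsR (fun n => complex.Im (u n)).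
  move=> e /cu [N h]; exists N => m n Nm Nn; apply: le_lt_trans (h _ _ Nm Nn).
  by apply: le_trans (Im_le_rnorm _); case: (u m) (u n) => [? ?] [? ?].
exists (Complex a b).
apply: (@tends_squeeze _ _ _ _ (fun n => `|complex.Re (u n) - a| + `|complex.Im (u n) - b|)).
  by move=> n; apply: le_trans (rnorm_le_ReIm _) _; case: (u n).
rewrite -[0 in X in _ --> X]addr0.
by apply: cvgD; apply/(@norm_cvg0P R R^o)/subr_cvg0.
Qed.

End BoundedMaps.

(** * Absolutely convergent series *)

Section Series.
Variables (R : realType).
Local Notation C := R[i].

Definition sums (V : normedZmodType C) (a : nat -> V) (s : V) :=
  tends (fun n => \sum_(k < n) a k) s.

Definition bounded_sums (M : nat -> R) := exists B : R, forall n, \sum_(k < n) M k <= B.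

Lemma sums0 (V : normedZmodType C) : sums (fun=> 0 : V) 0.
Proof.
rewrite /sums (_ : (fun n => _) = fun=> 0); first exact: tends_cst.
by apply: funext => n; rewrite big1.
Qed.

Lemma sumsD (V : normedZmodType C) (a b : nat -> V) s t :
  sums a s -> sums b t -> sums (fun k => a k + b k) (s + t).
Proof.
move=> sa tb; rewrite /sums (_ : (fun n => _) =
  fun n => \sum_(k < n) a k + \sum_(k < n) b k); first exact: tendsD.
by apply: funext => n; rewrite big_split.
Qed.

Lemma sums_sum (V : normedZmodType C) (J : Type) (r : seq J) (a : J -> nat -> V) (s : J -> V) :
  (forall j, sums (a j) (s j)) -> sums (fun k => \sum_(j <- r) a j k) (\sum_(j <- r) s j).
Proof.
move=> h; elim: r => [|j r IH].
  by rewrite big_nil (_ : (fun=> _) = fun=> 0); [exact: sums0|apply: funext => k; rewrite big_nil].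
rewrite big_cons (_ : (fun=> _) = fun k => a j k + \sum_(j <- r) a j k).
  exact: sumsD.
by apply: funext => k; rewrite big_cons.
Qed.

Lemma sums_unique (V : normedZmodType C) (a : nat -> V) s t : sums a s -> sums a t -> s = t.
Proof. exact: tends_unique. Qed.

Lemma ler_psum (M : nat -> R) m n : (forall k, 0 <= M k) -> (m <= n)%N ->
  \sum_(k < m) M k <= \sum_(k < n) M k.
Proof.
move=> M0 mn; rewrite -!(big_mkord xpredT M) (@big_cat_nat _ _ _ m 0 n)//=.
by rewrite lerDl sumr_ge0.
Qed.

Lemma bounded_sums_tail (M : nat -> R) : (forall k, 0 <= M k) -> bounded_sums M ->
  forall e : R, 0 < e -> exists N, forall n, \sum_(k < n) M k <= \sum_(k < N) M k + e.
Proof.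
move=> M0 [B MB] e e0; pose S := [set \sum_(k < n) M k | n in @setT nat].
have hS : has_sup S by split; [exists (\sum_(k < 0) M k), 0%N|exists B => _ [n _ <-]].
have [_ [N _ <-] h] := sup_adherent e0 hS.
exists N => n; have : \sum_(k < n) M k <= sup S by apply: sup_upper_bound => //; exists n.
by lra.
Qed.

Lemma rnorm_sumB_le (V : normedZmodType C) (a : nat -> V) (M : nat -> R) m n :
  (forall k, rnorm (a k) <= M k) -> (m <= n)%N ->
  rnorm (\sum_(k < n) a k - \sum_(k < m) a k) <= \sum_(k < n) M k - \sum_(k < m) M k.
Proof.
move=> aM mn; rewrite -!(big_mkord xpredT M) -!(big_mkord xpredT a).
rewrite !(@big_cat_nat _ _ _ m 0 n)//= addrAC subrr add0r [leRHS]addrAC subrr add0r.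
by apply: (le_trans (rnorm_sum _ _ _)); apply: ler_sum.
Qed.

Lemma abs_sums (a : nat -> C) (M : nat -> R) : (forall k, rnorm (a k) <= M k) ->
  bounded_sums M -> exists s, sums a s.
Proof.
move=> aM MB; have M0 k : 0 <= M k by apply: le_trans (aM k); exact: rnorm_ge0.
apply: cauchy_tendsC => e e0; have e2 : 0 < e / 2 by rewrite divr_gt0.
have [N NM] := bounded_sums_tail M0 MB e2; exists N => m n Nm Nn.
wlog mn : m n Nm Nn / (m <= n)%N.
  by move=> h; case: (leqP m n) => [|/ltnW] mn; [|rewrite rnorm_distC]; exact: h.
rewrite rnorm_distC; apply: (le_lt_trans (rnorm_sumB_le aM mn)).
by have := NM n; have := ler_psum M0 Nm; lra.
Qed.

(** Dominated convergence for series: beyond one index N all tails are at most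
    e / 4, whatever n, and the first N terms converge one by one. *)
Lemma tannery (a : nat -> nat -> C) (l : nat -> C) (s : nat -> C) (S : C) (M : nat -> R) :
  (forall n k, rnorm (a n k) <= M k) -> bounded_sums M ->
  (forall n, sums (a n) (s n)) -> sums l S ->
  (forall k, tends (fun n => a n k) (l k)) -> tends s S.
Proof.
move=> aM MB sa lS al.
have M0 k : 0 <= M k by apply: le_trans (aM 0%N k); exact: rnorm_ge0.
have lM k : rnorm (l k) <= M k by apply: tends_rnorm_le (al k) _.
apply/tendsP => e e0; have e4 : 0 < e / 4 by rewrite divr_gt0.
have [N NM] := bounded_sums_tail M0 MB e4.
have tail (b : nat -> C) t : (forall k, rnorm (b k) <= M k) -> sums b t ->
    rnorm (t - \sum_(k < N) b k) <= e / 4.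
  move=> bM bt; have : tends (fun n => \sum_(k < n + N) b k - \sum_(k < N) b k)
      (t - \sum_(k < N) b k).
    apply: tendsD; last exact: tends_cst.
    apply/tendsP => d d0; have /tendsP /(_ _ d0) [K _ h] := bt.
    by exists K => // n Kn; apply: h => /=; apply: leq_trans Kn (leq_addr _ _).
  move/tends_rnorm_le; apply => n.
  apply: (le_trans (rnorm_sumB_le bM (leq_addl n N))).
  by have := NM (n + N)%N; lra.
have /tendsP /(_ _ e4) : tends (fun n => \sum_(k < N) a n k) (\sum_(k < N) l k).
  exact: tends_sum.
apply: filterS => n h.
have -> : s n - S = (s n - \sum_(k < N) a n k) +
    ((\sum_(k < N) a n k - \sum_(k < N) l k) - (S - \sum_(k < N) l k)) by ring.
apply: (le_lt_trans (rnormD _ _)).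
have := rnormB (\sum_(k < N) a n k - \sum_(k < N) l k) (S - \sum_(k < N) l k).
have := tail _ _ (aM n) (sa n); have := tail _ _ lM lS; lra.
Qed.

End Series.

(** * Inner products *)

Section InnerProduct.
Variables (R : realType) (H : hilbert R).
Local Notation C := R[i].
Implicit Types x y z : H.

Lemma hipC x y : hip x y = Num.conj (hip y x).
Proof. by rewrite hermC expr0 mul1r. Qed.

Lemma hipxx x : hip x x = (rnorm x ^+ 2)%:C%C.
Proof. by rewrite hipE rnormE -rmorphXn. Qed.

Lemma hipZl (a : C) x y : hip (a *: x) y = a * hip x y.
Proof. by rewrite linearZl_LR. Qed.

Lemma hipZr (a : C) x y : hip x (a *: y) = Num.conj a * hip x y.
Proof. by rewrite linearZr_LR. Qed.

Lemma hipDl x y z : hip (x + y) z = hip x z + hip y z.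
Proof. exact: linearDl. Qed.

Lemma hipDr x y z : hip z (x + y) = hip z x + hip z y.
Proof. exact: linearDr. Qed.

Lemma hipBl x y z : hip (x - y) z = hip x z - hip y z.
Proof. exact: linearBl. Qed.

Lemma hipBr x y z : hip z (x - y) = hip z x - hip z y.
Proof. exact: linearBr. Qed.

Lemma hip0l x : hip 0 x = 0.
Proof. exact: linear0l. Qed.

Lemma hip0r x : hip x 0 = 0.
Proof. exact: linear0r. Qed.

Lemma hip_suml (J : Type) (r : seq J) (P : pred J) (f : J -> H) y :
  hip (\sum_(j <- r | P j) f j) y = \sum_(j <- r | P j) hip (f j) y.
Proof. exact: linear_sumlz. Qed.

Lemma hip_sumr (J : Type) (r : seq J) (P : pred J) (f : J -> H) y :
  hip y (\sum_(j <- r | P j) f j) = \sum_(j <- r | P j) hip y (f j).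
Proof. exact: linear_sumr. Qed.

(** Expanding the square norm of x - a y for a = <x, y> / <y, y>. *)
Lemma cauchy_schwarz x y : rnorm (hip x y) <= rnorm x * rnorm y.
Proof.
have [->|y0] := eqVneq y 0; first by rewrite hip0r !rnorm0 mulr0.
have ny0 : 0 < rnorm y by rewrite lt_def rnorm_ge0 andbT; apply: contra_neq y0 => /rnorm_eq0.
have y2 : hip y y != 0 by rewrite dnorm_eq0.
pose a := hip x y / hip y y.
have E : hip (x - a *: y) (x - a *: y) * hip y y = hip x x * hip y y - `|hip x y| ^+ 2.
  rewrite hipBl !hipBr !hipZl !hipZr normCK [hip y x]hipC /a rmorphM fmorphV /= -!hipC.
  by field.
have : 0 <= hip x x * hip y y - `|hip x y| ^+ 2 by rewrite -E mulr_ge0.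
rewrite !hipxx rnormE -rmorphXn -rmorphM -rmorphB /= ler0c subr_ge0 -exprMn.
by rewrite ler_sqr ?nnegrE ?mulr_ge0 ?rnorm_ge0.
Qed.

Lemma rnormD2 x y :
  rnorm (x + y) ^+ 2 = rnorm x ^+ 2 + rnorm y ^+ 2 + 2 * complex.Re (hip x y).
Proof.
have : hip (x + y) (x + y) = hip x x + hip y y + (hip x y + Num.conj (hip x y)).
  by rewrite hipDl !hipDr -hipC; ring.
rewrite !hipxx; move: (hip x y) => [a b] /= /(congr1 (@complex.Re R)) /= ->; ring.
Qed.

Lemma rnorm_pythagoras x y : hip x y = 0 -> rnorm (x + y) ^+ 2 = rnorm x ^+ 2 + rnorm y ^+ 2.
Proof. by move=> xy; rewrite rnormD2 xy mulr0 addr0. Qed.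

Lemma parallelogram x y :
  rnorm (x + y) ^+ 2 + rnorm (x - y) ^+ 2 = 2 * rnorm x ^+ 2 + 2 * rnorm y ^+ 2.
Proof. by rewrite !rnormD2 rnormN -scaleN1r hipZr rmorphN1 mulN1r raddfN /=; ring. Qed.

(** Null vectors are allowed, so that the index set [nat] covers all dimensions. *)
Definition orthosys (e : nat -> H) :=
  (forall i j, i != j -> hip (e i) (e j) = 0) /\ (forall i, e i = 0 \/ rnorm (e i) = 1).

Lemma hilbert_basisP (e : nat -> H) : hilbert_basis e <->
  orthosys e /\ forall x, (forall i, hip x (e i) = 0) -> x = 0.
Proof.
have E i : hip (e i) (e i) = 1 <-> rnorm (e i) = 1.
  rewrite hipxx; split=> [/complexI/eqP|->]; last by rewrite expr1n.
  by rewrite sqrf_eq1 => /orP[/eqP//|/eqP h]; have := rnorm_ge0 (e i); rewrite h; lra.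
split=> [[h1 h2 h3]|[[h1 h2] h3]]; split=> //.
  by split=> // i; case: (h2 i) => [|/E]; [left|right].
by move=> i; case: (h2 i) => [|/E]; [left|right].
Qed.

Section Projection.
Variables (e : nat -> H) (oe : orthosys e).

Definition proj n x := \sum_(k < n) hip x (e k) *: e k.

Fact proj_linear n : linear (proj n).
Proof.
move=> a x y; rewrite /proj scaler_sumr -big_split; apply: eq_bigr => k _ /=.
by rewrite linearPl scalerDl scalerA.
Qed.
HB.instance Definition _ n := GRing.isLinear.Build C H H *:%R (proj n) (@proj_linear n).

Lemma hip_proj n x i : (i < n)%N -> hip (proj n x) (e i) = hip x (e i).
Proof.
move=> lin; rewrite /proj hip_suml (bigD1 (Ordinal lin))//= big1 ?addr0 => [|k ki].
  rewrite hipZl; have [->|h] := oe.2 i; first by rewrite !hip0r mulr0.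
  by rewrite hipxx h expr1n mulr1.
by rewrite hipZl oe.1 ?mulr0.
Qed.

Lemma proj_orth n x i : (i < n)%N -> hip (x - proj n x) (e i) = 0.
Proof. by move=> lin; rewrite hipBl hip_proj// subrr. Qed.

Lemma hip_proj_proj n x y : hip (proj n x) y = \sum_(k < n) hip x (e k) * hip (e k) y.
Proof. by rewrite /proj hip_suml; apply: eq_bigr => k _; rewrite hipZl. Qed.

Lemma hip_sub_proj n x : hip (proj n x) (x - proj n x) = 0.
Proof.
by rewrite hip_proj_proj big1// => k _; rewrite [hip (e k) _]hipC proj_orth// rmorph0 mulr0.
Qed.

Lemma rnorm_proj2 n x : rnorm x ^+ 2 = rnorm (proj n x) ^+ 2 + rnorm (x - proj n x) ^+ 2.
Proof. by rewrite -(rnorm_pythagoras (hip_sub_proj n x)) addrC subrK. Qed.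

Lemma rnorm_proj n x : rnorm (proj n x) <= rnorm x.
Proof.
rewrite -ler_sqr ?nnegrE ?rnorm_ge0// (rnorm_proj2 n x) lerDl sqr_ge0//.
Qed.

Lemma rnorm_sub_proj n x : rnorm (x - proj n x) <= rnorm x.
Proof.
rewrite -ler_sqr ?nnegrE ?rnorm_ge0// [leRHS](rnorm_proj2 n x) lerDr sqr_ge0//.
Qed.

Lemma rnorm_projE n x : rnorm (proj n x) ^+ 2 = \sum_(k < n) rnorm (hip x (e k)) ^+ 2.
Proof.
apply: complexI; rewrite -hipxx hip_proj_proj rmorph_sum; apply: eq_bigr => k _.
by rewrite [hip (e k) _]hipC hip_proj// /= rmorphXn /= -rnormE normCK.
Qed.

Lemma proj_diff n m x : (n <= m)%N ->
  rnorm (proj m x - proj n x) ^+ 2 = rnorm (proj m x) ^+ 2 - rnorm (proj n x) ^+ 2.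
Proof.
move=> nm; suff /rnorm_pythagoras : hip (proj m x - proj n x) (proj n x) = 0.
  by rewrite subrK => ->; rewrite addrK.
rewrite [LHS]hipC hip_proj_proj big1 ?rmorph0// => k _.
by rewrite [hip (e k) _]hipC hipBl !hip_proj ?subrr ?rmorph0 ?mulr0// (leq_trans _ nm).
Qed.

(** Bessel's inequality makes the partial sums a Cauchy sequence. *)
Lemma proj_cauchy x : cauchy_seq (fun n => proj n x).
Proof.
pose M k := rnorm (hip x (e k)) ^+ 2; have M0 k : 0 <= M k by rewrite sqr_ge0.
have MB : bounded_sums M.
  exists (rnorm x ^+ 2) => n; rewrite -rnorm_projE.
  by rewrite ler_sqr ?nnegrE ?rnorm_ge0// rnorm_proj.
move=> d d0; have d2 : 0 < d ^+ 2 by rewrite exprn_gt0.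
have [|N NM] := bounded_sums_tail M0 MB (e := d ^+ 2 / 2); first by rewrite divr_gt0.
exists N => m n Nm Nn; wlog mn : m n Nm Nn / (n <= m)%N.
  by move=> h; case: (leqP n m) => [|/ltnW] mn; [|rewrite rnorm_distC]; exact: h.
rewrite -ltr_sqr ?nnegrE ?rnorm_ge0 ?ltW// proj_diff// !rnorm_projE.
have := NM m; have := ler_psum M0 Nn; rewrite -/(M _).
by move: d2; rewrite /M; lra.
Qed.

Lemma hip_tends u x y : tends u x -> tends (fun n => hip (u n) y) (hip x y).
Proof.
move=> ux; apply: (@tends_lipschitz _ _ _ (fun x => hip x y) (rnorm y)) => // a b.
by rewrite -hipBl mulrC cauchy_schwarz.
Qed.

End Projection.

(** The partial sums converge by Bessel's inequality, and the difference between
    x and their limit is orthogonal to the whole basis. *)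
Lemma proj_tends e x : hilbert_basis e -> tends (fun n => proj e n x) x.
Proof.
move=> /hilbert_basisP [oe te].
have [l xl] := cauchy_tends (proj_cauchy oe x).
suff xl0 : x = l by rewrite [X in tends _ X]xl0.
apply/eqP; rewrite -subr_eq0; apply/eqP/te => i; rewrite hipBl.
apply/eqP; rewrite subr_eq0; apply/eqP/esym; apply: tends_unique (hip_tends (e i) xl) _.
apply/tendsP => d d0; exists i.+1 => // n /= lin.
by rewrite hip_proj// subrr rnorm0.
Qed.

End InnerProduct.

(** * Compact operators *)

Section BoundedOps.
Variables (R : realType).
Local Notation C := R[i].
Implicit Types H K L : hilbert R.

Definition bounded_by H K (T : H -> K) (M : R) := forall x, rnorm (T x) <= M * rnorm x.

Lemma linear_lipschitz H K (T : {linear H -> K}) M : bounded_by T M ->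
  forall x y, rnorm (T x - T y) <= M * rnorm (x - y).
Proof. by move=> TM x y; rewrite -linearB; exact: TM. Qed.

Lemma tends_linear H K (T : {linear H -> K}) M u x : bounded_by T M ->
  tends u x -> tends (fun n => T (u n)) (T x).
Proof. by move=> TM; apply: tends_lipschitz; exact: linear_lipschitz TM. Qed.

Lemma continuous_linear H K (T : {linear H -> K}) M : bounded_by T M -> continuous T.
Proof.
move=> TM x; apply/cvgrPdist_lt => e e0.
have eE : e = (complex.Re e)%:C%C by rewrite RRe_real// gtr0_real.
have e0' : 0 < complex.Re e by rewrite -ltcR -eE.
have M0 : 0 < `|M| + 1 by rewrite ltr_wpDl.
near=> y; rewrite rnormE eE ltcR.
apply: (le_lt_trans (linear_lipschitz TM _ _)).
have : rnorm (x - y) < complex.Re e / (`|M| + 1).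
  rewrite -ltcR -rnormE; near: y.
  have d0 : 0 < (complex.Re e / (`|M| + 1))%:C%C by rewrite ltcR divr_gt0.
  by move: (@cvg_id _ (nbhs x)) => /cvgrPdist_lt /(_ _ d0).
rewrite ltr_pdivlMr// mulrC; apply: le_lt_trans.
rewrite ler_wpM2r ?rnorm_ge0// (le_trans (ler_norm M))// lerDl//.
Unshelve. all: by end_near. Qed.

Lemma compact_op_in H K (T : H -> K) (A : set K) :
  compact A -> (forall x, rnorm x <= 1 -> A (T x)) -> compact_op T.
Proof.
move=> cA TA; apply: (subclosed_compact (@closed_closure _ _) cA).
have /closure_id -> : closed A by exact: compact_closed (@norm_hausdorff _ _) cA.
by apply: closure_subset => _ [x x1 <-]; exact: TA.
Qed.

Lemma compact_opP H K (T : H -> K) : compact_op T ->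
  exists2 A : set K, compact A & forall x, rnorm x <= 1 -> A (T x).
Proof.
by move=> cT; eexists; [exact: cT|move=> x x1; apply: subset_closure; exists x].
Qed.

Lemma compact_opD H K (S T : H -> K) : compact_op S -> compact_op T ->
  compact_op (fun x => S x + T x).
Proof.
move=> /compact_opP[A cA SA] /compact_opP[B cB TB].
apply: (@compact_op_in _ _ _ ((fun z : K * K => z.1 + z.2) @` (A `*` B))).
  apply: continuous_compact; last exact: compact_setX.
  by apply: continuous_subspaceT; exact: add_continuous.
by move=> x x1; exists (S x, T x) => //; split; [exact: SA|exact: TB].
Qed.

Lemma compact_op_mull H K L (S : {linear K -> L}) (T : H -> K) M :
  bounded_by S M -> compact_op T -> compact_op (fun x => S (T x)).
Proof.
move=> SM /compact_opP[A cA TA]; apply: (@compact_op_in _ _ _ (S @` A)).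
  apply: continuous_compact cA; apply: continuous_subspaceT.
  exact: continuous_linear SM.
by move=> x x1; exists (T x) => //; exact: TA.
Qed.

Lemma compact_op_mulr H K L (S : {linear K -> L}) (T : H -> K) M :
  bounded_by T M -> compact_op S -> compact_op (fun x => S (T x)).
Proof.
move=> TM /compact_opP[A cA SA].
have M1 : 0 < `|M| + 1 by rewrite ltr_wpDl.
pose m : C := (`|M| + 1)%:C%C.
have m0 : m != 0 by rewrite gt_eqF// ltcR.
apply: (@compact_op_in _ _ _ ((fun z : L => m *: z) @` A)).
  apply: continuous_compact cA; apply: continuous_subspaceT => z.
  exact: scaler_continuous.
move=> x x1; exists (S (m^-1 *: T x)); last by rewrite linearZ scalerA mulfV// scale1r.
apply: SA; rewrite rnormZ -fmorphV rnorm_real ger0_norm ?invr_ge0 ?(ltW M1)//.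
rewrite mulrC ler_pdivrMr// mul1r (le_trans (TM x))// (le_trans (ler_norm _))//.
rewrite normrM (ger0_norm (rnorm_ge0 x)) (@le_trans _ _ (`|M| * 1))//.
  by rewrite ler_wpM2l.
by rewrite mulr1 lerDl.
Qed.

(** Sequential compactness in the form of a cluster value, which is visited
    infinitely often. *)
Lemma compact_freq K (A : set K) (u : nat -> K) : compact A -> (forall n, A (u n)) ->
  exists y, forall (e : R) N, 0 < e -> exists2 n, (N <= n)%N & rnorm (u n - y) < e.
Proof.
move=> cA Au; have [|y [_ cy]] := cA (u @ \oo) _.
  by exists 0%N => // n _; exact: Au.
exists y => e N e0.
have [] := cy (u @` [set n | (N <= n)%N]) (ball y e%:C%C).
- by exists N => // n Nn; exists n.
- by apply: nbhsx_ballx; rewrite ltcR.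
move=> _ [[n Nn <-]]; rewrite -ball_normE /= rnormE ltcR => h.
by exists n => //; rewrite rnorm_distC.
Qed.

End BoundedOps.

(** * Singular systems of compact operators *)

Section Maximizer.
Variables (R : realType) (H K : hilbert R) (T : {linear H -> K}) (M : R).
Hypotheses (TM : bounded_by T M) (cT : compact_op T).
Local Notation C := R[i].
Variable V : set H.
Hypothesis V_lin : forall (a : C) x y, V x -> V y -> V (a *: x + y).
Hypothesis V_closed : forall u x, (forall n, V (u n)) -> tends u x -> V x.

(** The unit sphere of V is not compact, but an almost maximizing sequence whose
    images cluster has a Cauchy subsequence, by the parallelogram law. *)
Lemma norm_attained (x0 : H) : V x0 -> x0 != 0 ->
  exists e, [/\ V e, rnorm e = 1 & forall x, V x -> rnorm (T x) <= rnorm (T e) * rnorm x].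
Proof.
move=> Vx0 x0N0.
have V0 : V 0 by have := V_lin (-1) Vx0 Vx0; rewrite scaleN1r addNr.
have VZ a x : V x -> V (a *: x) by move=> Vx; rewrite -[a *: x]addr0; exact: V_lin.
have VD x y : V x -> V y -> V (x + y) by move=> Vx; have := V_lin 1 Vx; rewrite scale1r; exact.
pose S := [set rnorm (T x) | x in [set x | V x /\ rnorm x = 1]].
have unit_ x : x != 0 -> rnorm ((rnorm x)^-1%:C%C *: x) = 1.
  move=> xN0; have nx : rnorm x != 0 by apply: contra_neq xN0 => /rnorm_eq0.
  by rewrite rnormZ rnorm_real ger0_norm ?invr_ge0 ?rnorm_ge0// mulVf.
pose x1 := (rnorm x0)^-1%:C%C *: x0.
have Vx1 : V x1 by exact: VZ.
have nx1 : rnorm x1 = 1 by exact: unit_.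
have hS : has_sup S.
  split; first by exists (rnorm (T x1)), x1.
  by exists M => _ [x [_ x_1] <-]; have := TM x; rewrite x_1 mulr1.
pose lam := sup S.
have lamP x : V x -> rnorm (T x) <= lam * rnorm x.
  move=> Vx; have [->|xN0] := eqVneq x 0; first by rewrite linear0 !rnorm0 mulr0.
  have nx : 0 < rnorm x by rewrite lt_def rnorm_ge0 andbT; apply: contra_neq xN0 => /rnorm_eq0.
  rewrite -ler_pdivrMr// mulrC.
  have -> : (rnorm x)^-1 * rnorm (T x) = rnorm (T ((rnorm x)^-1%:C%C *: x)).
    by rewrite linearZ rnormZ rnorm_real ger0_norm ?invr_ge0 ?rnorm_ge0.
  by apply: sup_upper_bound => //; exists ((rnorm x)^-1%:C%C *: x) => //; split; [exact: VZ|exact: unit_].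
suff [e [Ve e1 Te]] : exists e, [/\ V e, rnorm e = 1 & lam <= rnorm (T e)].
  exists e; split=> // x /lamP /le_trans; apply; by rewrite ler_wpM2r ?rnorm_ge0.
have [lam0|lam0] := leP lam 0.
  by exists x1; split=> //; exact: le_trans lam0 (rnorm_ge0 _).
pose d (n : nat) : R := n.+1%:R^-1.
have d0 n : 0 < d n by rewrite invr_gt0.
have dle m n : (m <= n)%N -> d n <= d m by move=> mn; rewrite lef_pV2 ?posrE// ler_nat.
have dlt (e : R) : 0 < e -> exists N, d N < e.
  by move=> e0; have [N _ h] := near_infty_natSinv_lt (PosNum e0); exists N; exact: h (leqnn N).
have [u uP] : exists u : nat -> H, forall n, [/\ V (u n), rnorm (u n) = 1 & lam - d n < rnorm (T (u n))].
  suff /choice[u uP] : forall n, exists x, [/\ V x, rnorm x = 1 & lam - d n < rnorm (T x)] by exists u.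
  by move=> n; have [_ [x [Vx xx] <-] h] := sup_adherent (d0 n) hS; exists x.
have [A cA TA] := compact_opP cT.
have [n|y yP] := @compact_freq _ _ A (T \o u) cA.
  by apply: TA; have [_ -> _] := uP n.
have [v vP] : exists v : nat -> H, forall n,
    [/\ V (v n), rnorm (v n) = 1, lam - d n < rnorm (T (v n)) & rnorm (T (v n) - y) < d n].
  suff /choice[v vP] : forall n, exists x, [/\ V x, rnorm x = 1, lam - d n < rnorm (T x) &
    rnorm (T x - y) < d n] by exists v.
  move=> n; have [k nk h] := yP _ n (d0 n); have [Vk k1 k2] := uP k.
  by exists (u k); split=> //; apply: le_lt_trans k2; have := dle _ _ nk; lra.
(* The sum of two almost maximizing unit vectors with close images has almost
   maximal norm 2, so that they are close by the parallelogram law. *)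
have close N m n : (N <= m)%N -> (N <= n)%N ->
    lam * rnorm (v m - v n) ^+ 2 <= 16 * d N.
  move=> Nm Nn; have [Vm m1 Tm ym] := vP m; have [Vn n1 Tn yn] := vP n.
  have := parallelogram (v m) (v n); rewrite m1 n1.
  have := lamP _ (VD _ _ Vm Vn); rewrite linearD.
  have := rnormD (T (v m) + T (v n)) (T (v m) - T (v n)).
  rewrite addrACA subrr addr0 -mulr2n -scaler_nat rnormZ.
  have -> : rnorm (2%:R : C) = 2 by rewrite /rnorm normr_nat.
  have := rnormB (T (v m) - y) (T (v n) - y); rewrite opprB addrA subrK.
  have := rnormD (v m) (v n); rewrite m1 n1.
  have := dle _ _ Nm; have := dle _ _ Nn; have := rnorm_ge0 (v m + v n).
  move: (rnorm (v m + v n)) (rnorm (v m - v n)) (rnorm (T (v m) + T (v n)))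
    (rnorm (T (v m) - T (v n))) Tm Tn ym yn => a b c e.
  move=> *.
  have : lam * a >= 2 * lam - 4 * d N by lra.
  have -> : b ^+ 2 = (2 - a) * (2 + a) by lra.
  move=> h; have : lam * (2 - a) * (2 + a) <= (4 * d N) * (2 + a).
    by apply: ler_wpM2r; lra.
  have : 0 <= d N * (2 - a) by apply: mulr_ge0; [exact: ltW|lra].
  by lra.
have [|e ve] := @cauchy_tends _ _ v.
  move=> r r0; have [|N hN] := dlt (lam * r ^+ 2 / 16).
    by rewrite divr_gt0// mulr_gt0// exprn_gt0.
  exists N => m n Nm Nn.
  rewrite -ltr_sqr ?nnegrE ?rnorm_ge0 ?(ltW r0)// -(ltr_pM2l lam0).
  have := close _ _ _ Nm Nn; lra.
have Te := tends_linear TM ve.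
exists e; split.
- by apply: V_closed ve => n; have [] := vP n.
- apply/eqP; rewrite eq_le; apply/andP; split.
    by apply: tends_rnorm_le ve _ => n; have [_ ->] := vP n.
  apply/ler_addgt0Pr => r r0; have /tendsP /(_ _ r0) [N _ /(_ N (leqnn N)) /= h] := ve.
  have := rnormB (v N) (v N - e); rewrite opprB addrC subrK.
  have := rnormD e (v N - e); rewrite addrC subrK; have [_ -> _ _] := vP N; lra.
- apply/ler_addgt0Pr => r r0; have r2 : 0 < r / 2 by rewrite divr_gt0.
  have /tendsP /(_ _ r2) [N _ h] := Te; have [N' hN'] := dlt _ r2.
  have := h (maxn N N') (leq_maxl _ _); have [_ _ + _] := vP (maxn N N').
  have := dle _ _ (leq_maxr N N').
  have := rnormD (T e) (T (v (maxn N N')) - T e); rewrite addrC subrK; lra.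
Qed.

(** First-order condition at a maximizer: perturbing [e] in the direction of
    [<T e, T y> y] with y orthogonal to [e] would otherwise increase the norm. *)
Lemma maximizer_eigenvector e : V e -> rnorm e = 1 ->
  (forall x, V x -> rnorm (T x) <= rnorm (T e) * rnorm x) ->
  forall y, V y -> hip (T e) (T y) = (rnorm (T e) ^+ 2)%:C%C * hip e y.
Proof.
move=> Ve e1 emax.
have orth y : V y -> hip e y = 0 -> hip (T e) (T y) = 0.
  move=> Vy ey; set w := hip (T e) (T y); apply: rnorm_eq0.
  pose W := rnorm w ^+ 2; pose B := rnorm (T e) ^+ 2 * rnorm y ^+ 2.
  have B0 : 0 <= B by rewrite mulr_ge0 ?sqr_ge0.
  have key (t : R) : 0 < t -> 2 * t * W <= t ^+ 2 * W * B.
    move=> t0; pose z : C := t%:C%C * w.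
    have := emax _ (V_lin z Vy Ve); rewrite -ler_sqr ?nnegrE ?mulr_ge0 ?rnorm_ge0//.
    rewrite exprMn linearP [z *: y + e]addrC [z *: T y + T e]addrC !rnormD2 !hipZr ey e1.
    rewrite -/w !rnormZ /z rmorphM /= -mulrA [Num.conj w * w]mulrC -normCK rnormE.
    rewrite rnormM rnorm_real (ger0_norm (ltW t0)) mulr0 /=.
    have : 0 <= t ^+ 2 * W * rnorm (T y) ^+ 2.
      by apply: mulr_ge0; [apply: mulr_ge0|]; exact: sqr_ge0.
    rewrite /B /W; lra.
  apply/eqP; rewrite -[_ == _](@expf_eq0 _ _ 2) eq_le sqr_ge0 andbT leNgt; apply/negP => W0.
  have B1 : 0 < B + 1 by rewrite ltr_wpDl.
  have t0 : 0 < (B + 1)^-1 by rewrite invr_gt0.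
  have /(ler_wpM2r (ltW B1)) /(ler_wpM2r (ltW B1)) := key _ t0.
  have -> : 2 * (B + 1)^-1 * W * (B + 1) * (B + 1) = 2 * W * (B + 1).
    by field; lra.
  have -> : (B + 1)^-1 ^+ 2 * W * B * (B + 1) * (B + 1) = W * B.
    by field; lra.
  have : 0 <= W * B by rewrite mulr_ge0// ltW.
  by rewrite -/W in W0; lra.
move=> y Vy; pose y' := (- hip y e) *: e + y.
have Vy' : V y' by exact: V_lin.
have ey' : hip e y' = 0.
  by rewrite hipDr hipZr hipxx e1 expr1n mulr1 rmorphN /= -hipC addNr.
have yE : y = hip y e *: e + y' by rewrite /y' scaleNr addNKr.
clearbody y'; move: (hip y e) yE => a ->.
rewrite linearP !hipDr !hipZr (orth _ Vy' ey') ey' !addr0 !hipxx e1 expr1n mulr1.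
by rewrite mulrC.
Qed.

End Maximizer.

Section SingularSystem.
Variables (R : realType) (H K : hilbert R).
Local Notation C := R[i].
Implicit Types (T : {linear H -> K}) (e : nat -> H).

(** These are the properties of a greedy choice of e_n maximizing |T x| over the
    unit vectors orthogonal to its predecessors, continued by null vectors once
    there is no such vector. The third clause is T^* T e_n = |T e_n|^2 e_n,
    tested against T y in order to avoid adjoints. *)
Definition singular_system T e :=
  [/\ orthosys e,
      forall n x, (forall i, (i < n)%N -> hip x (e i) = 0) ->
        rnorm (T x) <= rnorm (T (e n)) * rnorm x,
      forall n y, hip (T (e n)) (T y) = (rnorm (T (e n)) ^+ 2)%:C%C * hip (e n) y &
      forall m n, (m <= n)%N -> e m = 0 -> e n = 0].

(** The greedy choice gives the eigenvector equation on the orthogonal complement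
    of e_0, ..., e_(n-1) only; it extends to all vectors because it also holds
    for each e_k, k < n. *)
Lemma singular_system_exists T M : bounded_by T M -> compact_op T ->
  exists e, singular_system T e.
Proof.
move=> TM cT.
pose V (s : seq H) := [set x : H | forall y, y \in s -> hip x y = 0].
have Vlin s (a : C) x y : V s x -> V s y -> V s (a *: x + y).
  by move=> Vx Vy z zs; rewrite hipDl hipZl Vx// Vy// mulr0 addr0.
have Vclosed s u x : (forall n, V s (u n)) -> tends u x -> V s x.
  move=> Vu ux z zs; apply: tends_unique (hip_tends z ux) _.
  by rewrite (_ : (fun n => _) = fun=> 0); [exact: tends_cst|apply: funext => n; exact: Vu].
have step s : exists e : H, [/\ V s e, rnorm e = 1 \/ (forall x, V s x -> x = 0),
    forall x, V s x -> rnorm (T x) <= rnorm (T e) * rnorm x &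
    forall y, V s y -> hip (T e) (T y) = (rnorm (T e) ^+ 2)%:C%C * hip e y].
  have [[x [Vx x0]]|nx] := pselect (exists x, V s x /\ x != 0).
    have [e [Ve e1 emax]] := norm_attained TM cT (Vlin s) (@Vclosed s) Vx x0.
    exists e; split=> //; first by left.
    exact: (maximizer_eigenvector (Vlin s) Ve e1 emax).
  have V0 x : V s x -> x = 0.
    by move=> Vx; apply/eqP; apply: contra_notT nx => x0; exists x.
  exists 0; split=> [y _| |x /V0 ->|y /V0 ->]; rewrite ?hip0l//; first by right.
    by rewrite linear0 !rnorm0 mulr0.
  by rewrite mulr0 linear0 hip0l.
have [g gP] := choice step.
pose es n := iter n (fun s => g s :: s) [::].
pose e n := g (es n).
have esP n x : x \in es n <-> exists2 i, (i < n)%N & x = e i.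
  elim: n x => [|n IH] x; first by split=> // -[].
  rewrite /= inE; split=> [/orP[/eqP ->|/IH[k lkn ->]]|[k]].
  - by exists n.
  - by exists k => //; rewrite ltnS ltnW.
  rewrite ltnS leq_eqVlt => /orP[/eqP -> ->|lkn ->]; first by rewrite eqxx.
  by apply/orP; right; apply/IH; exists k.
have VP n x : V (es n) x <-> forall i, (i < n)%N -> hip x (e i) = 0.
  split=> [h i lin|h y /esP[i lin ->]]; last exact: h.
  by apply: h; apply/esP; exists i.
have Vle m n x : (m <= n)%N -> V (es n) x -> V (es m) x.
  by move=> mn /VP h; apply/VP => i im; apply: h; exact: leq_trans mn.
have Ve n : V (es n) (e n) by have [] := gP (es n).
have oe i j : i != j -> hip (e i) (e j) = 0.
  have lt_oe k l : (k < l)%N -> hip (e l) (e k) = 0 by move=> kl; have /VP := Ve l; apply.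
  by case: (ltngtP i j) => // ij _; [rewrite hipC|]; rewrite lt_oe ?rmorph0.
have eig n y : V (es n) y -> hip (T (e n)) (T y) = (rnorm (T (e n)) ^+ 2)%:C%C * hip (e n) y.
  by have [_ _ _] := gP (es n); apply.
have osys : orthosys e.
  split=> // n; have [_ [e1|e0] _ _] := gP (es n); first by right.
  by left; apply: e0.
exists e; split=> //.
- by move=> n x /VP Vx; have [_ _ + _] := gP (es n); apply.
- move=> n y; have Vy : V (es n) (y - proj e n y).
    by apply/VP => i lin; rewrite proj_orth.
  rewrite -[y in LHS](subrK (proj e n y)) -[y in RHS](subrK (proj e n y)).
  rewrite linearD [LHS]hipDr (eig n _ Vy) [in RHS]hipDr mulrDr; congr (_ + _).
  have -> : hip (e n) (proj e n y) = 0.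
    by rewrite hip_sumr big1// => k _; rewrite hipZr oe ?mulr0// neq_ltn ltn_ord orbT.
  rewrite mulr0 linear_sum hip_sumr big1// => k _; rewrite linearZ hipZr.
  rewrite [hip (T (e n)) _]hipC eig; last by apply: Vle (Ve n); rewrite ltnW.
  by rewrite oe ?mulr0 ?rmorph0 ?mulr0// neq_ltn ltn_ord.
- move=> m n mn em0; have [_ [em1|h] _ _] := gP (es m).
    by move: em1; rewrite -/(e m) em0 rnorm0 => /eqP; rewrite eq_sym oner_eq0.
  by apply: h; exact: Vle mn (Ve n).
Qed.

Lemma singular_system_le T e m n : singular_system T e -> (m <= n)%N ->
  rnorm (T (e n)) <= rnorm (T (e m)).
Proof.
move=> [[oe e1] emax _ _] mn; apply: (le_trans (emax m _ _)).
  by move=> i im; rewrite oe// neq_ltn (leq_trans im mn) orbT.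
rewrite ler_piMr ?rnorm_ge0//.
by case: (e1 n) => ->; rewrite ?rnorm0// ler01.
Qed.

Lemma singular_system_orth T e : singular_system T e ->
  forall i j, i != j -> hip (T (e i)) (T (e j)) = 0.
Proof. by move=> [[oe _] _ eig _] i j ij; rewrite eig oe ?mulr0. Qed.

(** The T e_n are pairwise orthogonal, so that they would have no cluster value
    if their norms stayed away from 0. *)
Lemma singular_system_cvg0 T e : compact_op T -> singular_system T e ->
  (rnorm (T (e n)) @[n --> \oo] --> (0 : R)).
Proof.
move=> cT eT; apply/cvgr0Pnorm_lt => d d0.
have [[n h]|nh] := pselect (exists n, rnorm (T (e n)) < d).
  exists n => // m /= nm; rewrite ger0_norm ?rnorm_ge0//.
  exact: le_lt_trans (singular_system_le eT nm) h.
have {}nh n : d <= rnorm (T (e n)).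
  by rewrite leNgt; apply/negP => h; apply: nh; exists n.
have [[_ e1] _ _ _] := eT.
have [A cA TA] := compact_opP cT.
have [n|y yP] := @compact_freq _ _ A (T \o e) cA.
  by apply: TA; case: (e1 n) => ->; rewrite ?rnorm0// ler01.
have d2 : 0 < d / 2 by rewrite divr_gt0.
have [i _ iy] := yP _ 0%N d2; have [j ij jy] := yP _ i.+1 d2.
have := rnormB (T (e i) - y) (T (e j) - y); rewrite opprB addrA subrK.
move: iy jy => /= iy jy; set r := rnorm (_ - _) => h.
have : r ^+ 2 = rnorm (T (e i)) ^+ 2 + rnorm (T (e j)) ^+ 2.
  rewrite /r rnorm_pythagoras ?rnormN// -scaleN1r hipZr.
  by rewrite (singular_system_orth eT) ?mulr0// neq_ltn ij.
have : r ^+ 2 < d ^+ 2 by rewrite ltr_sqr ?nnegrE ?rnorm_ge0 ?(ltW d0)//; lra.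
have : d ^+ 2 <= rnorm (T (e i)) ^+ 2 by rewrite ler_sqr ?nnegrE ?rnorm_ge0 ?(ltW d0)//.
have := sqr_ge0 (rnorm (T (e j))); lra.
Qed.

Lemma singular_value_ge0 T n : 0 <= singular_value T n.
Proof.
rewrite /singular_value; set S := [set l | _].
have [hS|/sup_out ->//] := pselect (has_sup S).
have [[l Sl] _] := hS.
by apply: (@le_trans _ _ l); [have [] := Sl|exact: sup_upper_bound].
Qed.

End SingularSystem.

(** * Gelfand numbers *)

Section Gelfand.
Variable R : realType.
Local Notation C := R[i].
Implicit Types H K L : hilbert R.

(** The least such c is the n-th Gelfand number of T. Unlike singular values,
    these bounds are visibly compatible with sums and composition. *)
Definition gelfand_bound H K (T : H -> K) (n : nat) (c : R) :=
  exists phi : {linear H -> 'rV[C]_n}, forall x, phi x = 0 -> rnorm (T x) <= c * rnorm x.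

Lemma rnorm_orthonormal_comb H (I : finType) (e : I -> H) (a : I -> C) :
  (forall i j, hip (e i) (e j) = (i == j)%:R) ->
  rnorm (\sum_i a i *: e i) ^+ 2 = \sum_i rnorm (a i) ^+ 2.
Proof.
move=> oe; apply: complexI; rewrite -hipxx hip_suml rmorph_sum; apply: eq_bigr => i _.
rewrite hip_sumr (bigD1 i)//= big1 => [|j ji]; rewrite hipZl hipZr oe.
  by rewrite eqxx mulr1 addr0 -normCK rnormE -rmorphXn.
by rewrite eq_sym (negbTE ji) !mulr0.
Qed.

Lemma rnorm_image_comb H K (T : {linear H -> K}) (I : finType) (e : I -> H) (a : I -> C)
    (m : I -> R) :
  (forall i j, hip (e i) (e j) = (i == j)%:R) ->
  (forall i y, hip (T (e i)) (T y) = hip ((m i ^+ 2)%:C%C *: e i) y) ->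
  rnorm (T (\sum_i a i *: e i)) ^+ 2 = \sum_i m i ^+ 2 * rnorm (a i) ^+ 2.
Proof.
move=> oe eig; have -> : T (\sum_i a i *: e i) = \sum_i a i *: T (e i).
  by rewrite linear_sum; apply: eq_bigr => i _; rewrite linearZ.
apply: complexI; rewrite -hipxx hip_suml rmorph_sum; apply: eq_bigr => i _.
rewrite hip_sumr (bigD1 i)//= big1 => [|j ji]; rewrite hipZl hipZr eig hipZl oe.
  rewrite eqxx mulr1 addr0 mulrA -normCK rnormE.
  by rewrite mulrC -rmorphXn -rmorphM.
by rewrite eq_sym (negbTE ji) !mulr0.
Qed.

(** An (n+1)-dimensional space of eigenvectors meets every subspace of
    codimension n in a nonzero vector. *)
Lemma singular_value_le H K (T : {linear H -> K}) n c : 0 <= c ->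
  gelfand_bound T n c -> singular_value T n <= c.
Proof.
move=> c0 [phi phiT]; rewrite /singular_value; set S := [set l | _].
have [[S0 _]|/sup_out ->//] := pselect (has_sup S).
apply: ge_sup => // l [l0 [e [m [oe lm eig]]]].
pose A : 'M[C]_(n.+1, n) := \matrix_i phi (e i).
have [a [a0 aA]] : exists a : 'rV[C]_n.+1, a != 0 /\ a *m A = 0.
  have : kermx A != 0.
    rewrite kermx_eq0 /row_free; apply: contraTneq (rank_leq_col A) => ->.
    by rewrite -ltnNge.
  by move=> /rowV0Pn[a /sub_kermxP aA a0]; exists a.
pose x := \sum_i a 0 i *: e i.
have phix : phi x = 0.
  rewrite -aA mulmx_sum_row linear_sum; apply: eq_bigr => i _.
  by rewrite linearZ rowK.
have xx := rnorm_orthonormal_comb (a 0) oe; rewrite -/x in xx.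
have xpos : 0 < rnorm x ^+ 2.
  rewrite lt_def sqr_ge0 andbT xx psumr_neq0 => [|i _]; last exact: sqr_ge0.
  apply/hasPn => h; apply/negP: a0; rewrite negbK; apply/eqP/rowP => i; rewrite mxE.
  have := h i (mem_index_enum i); rewrite /= lt_def sqr_ge0 andbT negbK sqrf_eq0.
  by move=> /eqP /rnorm_eq0.
rewrite -ler_sqr ?nnegrE// -(ler_pM2r xpos).
apply: (@le_trans _ _ (rnorm (T x) ^+ 2)).
  rewrite (rnorm_image_comb _ oe eig) xx mulr_sumr; apply: ler_sum => i _.
  rewrite ler_wpM2r ?sqr_ge0// ler_sqr ?nnegrE//.
  exact: le_trans l0 (lm i).
by rewrite -exprMn ler_sqr ?nnegrE ?mulr_ge0 ?rnorm_ge0// phiT.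
Qed.

Lemma singular_system_gelfand H K (T : {linear H -> K}) e n : singular_system T e ->
  gelfand_bound T n (rnorm (T (e n))).
Proof.
move=> [_ emax _ _].
pose phi (x : H) : 'rV[C]_n := \row_i hip x (e i).
have phi_lin : linear phi by move=> a x y; apply/rowP => i; rewrite !mxE hipDl hipZl.
pose phiL : {linear H -> 'rV[C]_n} := HB.pack phi (GRing.isLinear.Build _ _ _ _ phi phi_lin).
exists phiL => x /rowP phix; apply: emax => i lin.
by have := phix (Ordinal lin); rewrite !mxE.
Qed.

Lemma singular_value_sup H K (T : {linear H -> K}) M e n : bounded_by T M ->
  singular_system T e -> rnorm (T (e n)) <= singular_value T n.
Proof.
move=> TM eT; have [[oe e1] _ eig e0] := eT.
have [en0|en1] := e1 n; first by rewrite en0 linear0 rnorm0 singular_value_ge0.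
have ei1 i : (i <= n)%N -> rnorm (e i) = 1.
  move=> le_in; have [ei0|//] := e1 i; move: en1; rewrite (e0 _ _ le_in ei0) rnorm0.
  by move/esym/eqP; rewrite oner_eq0.
apply: sup_upper_bound; last first.
  split; first exact: rnorm_ge0.
  exists (fun i : 'I_n.+1 => e i), (fun i : 'I_n.+1 => rnorm (T (e i))); split.
  - move=> i j; have [->|ij] := eqVneq i j; last by rewrite oe.
    by rewrite hipxx ei1 ?expr1n// -ltnS.
  - by move=> i; apply: singular_system_le eT _; rewrite -ltnS.
  - by move=> i y; rewrite eig hipZl.
split.
  exists 0; split=> //; exists (fun i : 'I_n.+1 => e i), (fun i : 'I_n.+1 => rnorm (T (e i))).
  split=> [i j|i|i y]; last by rewrite eig hipZl.
    have [->|ij] := eqVneq i j; last by rewrite oe.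
    by rewrite hipxx ei1 ?expr1n// -ltnS.
  exact: rnorm_ge0.
exists M => l [l0 [f [m [of_ lm eigf]]]].
have f1 : rnorm (f ord0) = 1.
  have /eqP := of_ ord0 ord0; rewrite eqxx hipxx; move=> /eqP/complexI/eqP.
  rewrite sqrf_eq1 => /orP[/eqP//|/eqP h].
  by have := rnorm_ge0 (f ord0); rewrite h; lra.
have := TM (f ord0); rewrite f1 mulr1; apply: le_trans.
have mE : rnorm (T (f ord0)) ^+ 2 = m ord0 ^+ 2.
  by apply: complexI; rewrite -hipxx eigf hipZl of_ mulr1.
apply: (le_trans (lm ord0)); rewrite -ler_sqr ?nnegrE ?rnorm_ge0 ?mE//.
exact: le_trans l0 (lm _).
Qed.

(** The upper bound is the restriction to the orthogonal complement of
    e_0, ..., e_(n-1); the lower bound is given by e_0, ..., e_n themselves. *)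
Lemma singular_valueE H K (T : {linear H -> K}) M e n : bounded_by T M ->
  singular_system T e -> singular_value T n = rnorm (T (e n)).
Proof.
move=> TM eT; apply/eqP; rewrite eq_le (singular_value_sup _ TM eT) andbT.
by apply: singular_value_le (rnorm_ge0 _) _; exact: singular_system_gelfand.
Qed.

Lemma gelfand_singular_value H K (T : {linear H -> K}) M n : bounded_by T M ->
  compact_op T -> gelfand_bound T n (singular_value T n).
Proof.
move=> TM cT; have [e eT] := singular_system_exists TM cT.
by rewrite (singular_valueE _ TM eT); exact: singular_system_gelfand.
Qed.

Lemma gelfand0 H K (T : {linear H -> K}) M : bounded_by T M -> gelfand_bound T 0 M.
Proof.
move=> TM; pose f (x : H) : 'rV[C]_0 := 0.
have f_lin : linear f by move=> a x y; rewrite /f scaler0 addr0.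
pose fL : {linear H -> 'rV[C]_0} := HB.pack f (GRing.isLinear.Build _ _ _ _ f f_lin).
by exists fL => x _; exact: TM.
Qed.

Lemma gelfandD H K (S T : {linear H -> K}) m n c d : gelfand_bound S m c ->
  gelfand_bound T n d -> gelfand_bound (fun x => S x + T x) (m + n) (c + d).
Proof.
move=> [phi phiS] [psi psiT].
pose f (x : H) : 'rV[C]_(m + n) := row_mx (phi x) (psi x).
have f_lin : linear f by move=> a x y; rewrite /f !linearP scale_row_mx add_row_mx.
pose fL : {linear H -> 'rV[C]_(m + n)} := HB.pack f (GRing.isLinear.Build _ _ _ _ f f_lin).
exists fL => x /= /eqP; rewrite row_mx_eq0 => /andP[/eqP px /eqP qx].
rewrite (le_trans (rnormD _ _))// mulrDl lerD//; [exact: phiS|exact: psiT].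
Qed.

(** The preimage under T of a subspace of codimension m has codimension at most
    m again. *)
Lemma gelfandM H K L (S : {linear K -> L}) (T : {linear H -> K}) m n c d : 0 <= c ->
  gelfand_bound S m c -> gelfand_bound T n d ->
  gelfand_bound (fun x => S (T x)) (m + n) (c * d).
Proof.
move=> c0 [phi phiS] [psi psiT].
pose f (x : H) : 'rV[C]_(m + n) := row_mx (phi (T x)) (psi x).
have f_lin : linear f by move=> a x y; rewrite /f !linearP scale_row_mx add_row_mx.
pose fL : {linear H -> 'rV[C]_(m + n)} := HB.pack f (GRing.isLinear.Build _ _ _ _ f f_lin).
exists fL => x /= /eqP; rewrite row_mx_eq0 => /andP[/eqP px /eqP qx].
rewrite (le_trans (phiS _ px))// -mulrA ler_wpM2l//; exact: psiT.
Qed.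

Lemma singular_value_antitone H K (T : {linear H -> K}) M m n : bounded_by T M ->
  compact_op T -> (m <= n)%N -> singular_value T n <= singular_value T m.
Proof.
move=> TM cT mn; have [e eT] := singular_system_exists TM cT.
by rewrite !(singular_valueE _ TM eT); exact: singular_system_le eT mn.
Qed.

End Gelfand.

(** * Schatten classes *)

Section PowerSums.
Variable R : realType.
Implicit Types (a b s : nat -> R) (q r t : R).

Lemma bounded_sums_le a b : (forall k, a k <= b k) -> bounded_sums b -> bounded_sums a.
Proof.
move=> ab [B bB]; exists B => n; apply: le_trans (bB n); exact: ler_sum.
Qed.

Lemma bounded_sumsD a b : bounded_sums a -> bounded_sums b ->
  bounded_sums (fun k => a k + b k).
Proof. by move=> [A aA] [B bB]; exists (A + B) => n; rewrite big_split lerD. Qed.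

Lemma bounded_sumsZ (c : R) a : 0 <= c -> bounded_sums a -> bounded_sums (fun k => c * a k).
Proof. by move=> c0 [A aA]; exists (c * A) => n; rewrite -mulr_sumr ler_wpM2l. Qed.

(** Gelfand bounds for sums and products control only every second singular
    value, which is enough as singular values decrease. *)
Lemma bounded_sums_double a b : (forall k, 0 <= a k) ->
  (forall m n, (m <= n)%N -> a n <= a m) -> (forall k, a (k + k)%N <= b k) ->
  bounded_sums b -> bounded_sums a.
Proof.
move=> a0 adec ab [B bB]; exists (2 * B) => n.
apply: (@le_trans _ _ (\sum_(k < (n + n)%N) a k)).
  exact: ler_psum (leq_addr _ _).
apply: (@le_trans _ _ (2 * \sum_(k < n) b k)); last by rewrite ler_wpM2l.
elim: n => [|n IH]; first by rewrite !big_ord0 mulr0.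
rewrite addnS addSn !big_ord_recr /=.
by have := ab n; have := adec _ _ (leqnSn (n + n)); lra.
Qed.

Lemma powRD_le (x y q : R) : 0 <= q -> 0 <= x -> 0 <= y ->
  (x + y) `^ q <= 2 `^ q * (x `^ q + y `^ q).
Proof.
move=> q0; wlog xy : x y / x <= y.
  by move=> h x0 y0; case: (leP x y) => [|/ltW] xy; [|rewrite addrC (addrC (x `^ q))]; exact: h.
move=> x0 y0; apply: (@le_trans _ _ ((2 * y) `^ q)).
  by rewrite ge0_ler_powR ?nnegrE//; lra.
by rewrite powRM// ler_wpM2l ?powR_ge0// lerDr powR_ge0.
Qed.

(** If m is the larger of x^q and y^r, then x y <= m^(1/q) m^(1/r) = m^(1/t). *)
Lemma powRM_le (x y q r t : R) : 0 < q -> 0 < r -> 0 < t -> t^-1 = q^-1 + r^-1 ->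
  0 <= x -> 0 <= y -> (x * y) `^ t <= x `^ q + y `^ r.
Proof.
move=> q0 r0 t0 tE x0 y0; set m := Num.max (x `^ q) (y `^ r).
have m0 : 0 <= m by rewrite le_max powR_ge0.
have root (z u : R) : 0 <= z -> 0 < u -> z `^ u <= m -> z <= m `^ u^-1.
  move=> z0 u0 zm; rewrite -[leLHS](@powRr1 _ z)// -(mulfV (lt0r_neq0 u0)) powRrM.
  by rewrite ge0_ler_powR ?nnegrE ?powR_ge0 ?invr_ge0 ?(ltW u0).
apply: (@le_trans _ _ m); last first.
  by rewrite ge_max lerDl lerDr !powR_ge0.
apply: (@le_trans _ _ ((m `^ q^-1 * m `^ r^-1) `^ t)).
  rewrite ge0_ler_powR ?nnegrE ?mulr_ge0 ?powR_ge0 ?(ltW t0)//.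
  by apply: ler_pM => //; apply: root; rewrite // le_max lexx ?orbT.
rewrite -powRD; last by rewrite gt_eqF// addr_gt0 ?invr_gt0.
by rewrite -tE -powRrM mulVf ?gt_eqF// powRr1.
Qed.

End PowerSums.

Section SchattenOps.
Variable R : realType.
Local Notation C := R[i].
Implicit Types H K L : hilbert R.
Implicit Types q r t : R.

Definition schatten_op q H K (T : H -> K) :=
  compact_op T /\ bounded_sums (fun n => singular_value T n `^ q).

Lemma schatten_normP q H K (T : H -> K) : 0 < q ->
  (schatten_norm q T < +oo)%E <-> bounded_sums (fun n => singular_value T n `^ q).
Proof.
move=> q0; have s0 k : (0 <= (singular_value T k `^ q)%:E)%E by rewrite lee_fin powR_ge0.
have E n : (\sum_(0 <= k < n) (singular_value T k `^ q)%:E)%E =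
    (\sum_(k < n) singular_value T k `^ q)%:E by rewrite sumEFin big_mkord.
rewrite /schatten_norm; set S := (\sum_(_ <= _ <oo) _)%E.
have S0 : (0 <= S)%E by exact: nneseries_ge0.
transitivity (S < +oo)%E.
  split=> [h|].
    rewrite ltey; apply: contraTneq h => ->; rewrite poweRyr ?ltxx//.
    by rewrite invr_eq0 gt_eqF.
  by rewrite !ltey; apply: contraNneq => /poweR_eqy ->.
split=> [Sy|[B sB]].
  exists (fine S) => n; rewrite -lee_fin fineK ?ge0_fin_numE// -E.
  exact: nneseries_lim_ge.
apply: (@le_lt_trans _ _ B%:E); last exact: ltry.
apply: lime_le; first exact: is_cvg_nneseries.
by apply: nearW => n; rewrite E lee_fin.
Qed.

Section Ideal.
Variables (H K L : hilbert R).

Lemma schatten_opD q (S T U : {linear H -> K}) M N : 0 < q ->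
  bounded_by S M -> bounded_by T N -> (forall x, U x = S x + T x) ->
  schatten_op q S -> schatten_op q T -> schatten_op q U.
Proof.
move=> q0 SM TN UE [cS bS] [cT bT].
have UE' : U = (fun x => S x + T x) :> (H -> K) by apply: funext => x; exact: UE.
have cU : compact_op U by rewrite UE'; exact: compact_opD.
have UMN : bounded_by U (M + N).
  by move=> x; rewrite UE (le_trans (rnormD _ _))// mulrDl lerD.
split; first exact: cU.
apply: (@bounded_sums_double _ _ (fun k => 2 `^ q *
  (singular_value S k `^ q + singular_value T k `^ q))).
- by move=> k; exact: powR_ge0.
- move=> m n mn; rewrite ge0_ler_powR ?nnegrE ?singular_value_ge0 ?(ltW q0)//.
  exact: singular_value_antitone UMN cU mn.
- move=> k; apply: (@le_trans _ _ ((singular_value S k + singular_value T k) `^ q)).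
    rewrite ge0_ler_powR ?nnegrE ?addr_ge0 ?singular_value_ge0 ?(ltW q0)//.
    apply: singular_value_le; first by rewrite addr_ge0 ?singular_value_ge0.
    by rewrite UE'; apply: gelfandD; apply: gelfand_singular_value.
  by apply: powRD_le; rewrite ?singular_value_ge0 ?(ltW q0).
- by apply: bounded_sumsZ; [exact: powR_ge0|exact: bounded_sumsD].
Qed.

Lemma schatten_op_mull q (S : {linear K -> L}) (T : {linear H -> K}) (U : {linear H -> L}) M N :
  0 < q -> bounded_by S M -> bounded_by T N -> (forall x, U x = S (T x)) ->
  schatten_op q T -> schatten_op q U.
Proof.
move=> q0 SM TN UE [cT bT].
have UE' : U = (fun x => S (T x)) :> (H -> L) by apply: funext => x; exact: UE.
split; first by rewrite UE'; exact: compact_op_mull SM cT.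
apply: (bounded_sums_le (b := fun k => `|M| `^ q * singular_value T k `^ q)) => [k|].
  rewrite -powRM ?singular_value_ge0// ge0_ler_powR
    ?nnegrE ?mulr_ge0 ?singular_value_ge0 ?(ltW q0)//.
  apply: singular_value_le; first by rewrite mulr_ge0 ?singular_value_ge0.
  rewrite UE' -[k]add0n; apply: gelfandM => //; last exact: gelfand_singular_value TN cT.
  apply: gelfand0 => x; rewrite (le_trans (SM x))// ler_wpM2r ?rnorm_ge0//.
  exact: ler_norm.
by apply: bounded_sumsZ => //; exact: powR_ge0.
Qed.

Lemma schatten_op_mulr q (S : {linear K -> L}) (T : {linear H -> K}) (U : {linear H -> L}) M N :
  0 < q -> bounded_by S M -> bounded_by T N -> (forall x, U x = S (T x)) ->
  schatten_op q S -> schatten_op q U.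
Proof.
move=> q0 SM TN UE [cS bS].
have UE' : U = (fun x => S (T x)) :> (H -> L) by apply: funext => x; exact: UE.
split; first by rewrite UE'; exact: compact_op_mulr TN cS.
apply: (bounded_sums_le (b := fun k => `|N| `^ q * singular_value S k `^ q)) => [k|].
  rewrite -powRM ?singular_value_ge0// ge0_ler_powR
    ?nnegrE ?mulr_ge0 ?singular_value_ge0 ?(ltW q0)//.
  apply: singular_value_le; first by rewrite mulr_ge0 ?singular_value_ge0.
  rewrite UE' -[k]addn0 mulrC; apply: gelfandM; first exact: singular_value_ge0.
    by rewrite addn0; exact: gelfand_singular_value SM cS.
  apply: gelfand0 => x; rewrite (le_trans (TN x))// ler_wpM2r ?rnorm_ge0//.
  exact: ler_norm.
by apply: bounded_sumsZ => //; exact: powR_ge0.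
Qed.

(** Hoelder's inequality for Schatten classes without its sharp constant, from
    s_(2k)(S T) <= s_k(S) s_k(T). *)
Lemma schatten_opM q r t (S : {linear K -> L}) (T : {linear H -> K}) (U : {linear H -> L}) M N :
  0 < q -> 0 < r -> 0 < t -> t^-1 = q^-1 + r^-1 ->
  bounded_by S M -> bounded_by T N -> (forall x, U x = S (T x)) ->
  schatten_op q S -> schatten_op r T -> schatten_op t U.
Proof.
move=> q0 r0 t0 tE SM TN UE [cS bS] [cT bT].
have UE' : U = (fun x => S (T x)) :> (H -> L) by apply: funext => x; exact: UE.
have cU : compact_op U by rewrite UE'; exact: compact_op_mulr TN cS.
have UMN : bounded_by U (`|M| * N).
  move=> x; rewrite UE (le_trans (SM _))// (@le_trans _ _ (`|M| * rnorm (T x)))//.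
    by rewrite ler_wpM2r ?rnorm_ge0 ?ler_norm.
  by rewrite -mulrA ler_wpM2l.
split; first exact: cU.
apply: (@bounded_sums_double _ _ (fun k =>
  singular_value S k `^ q + singular_value T k `^ r)).
- by move=> k; exact: powR_ge0.
- move=> m n mn; rewrite ge0_ler_powR ?nnegrE ?singular_value_ge0 ?(ltW t0)//.
  exact: singular_value_antitone UMN cU mn.
- move=> k; apply: (@le_trans _ _ ((singular_value S k * singular_value T k) `^ t)).
    rewrite ge0_ler_powR ?nnegrE ?mulr_ge0 ?singular_value_ge0 ?(ltW t0)//.
    apply: singular_value_le; first by rewrite mulr_ge0 ?singular_value_ge0.
    rewrite UE'; apply: gelfandM; first exact: singular_value_ge0.
      exact: gelfand_singular_value SM cS.
    exact: gelfand_singular_value TN cT.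
  by apply: powRM_le; rewrite ?singular_value_ge0.
- exact: bounded_sumsD.
Qed.

(** Singular values are bounded, so that s^r <= M^(r - q) s^q. *)
Lemma schatten_op_le q r (T : {linear H -> K}) M : 0 < q -> q <= r ->
  bounded_by T M -> schatten_op q T -> schatten_op r T.
Proof.
move=> q0 qr TM [cT bT]; split=> //.
apply: (bounded_sums_le (b := fun k => `|M| `^ (r - q) * singular_value T k `^ q)) => [k|].
  have sM : singular_value T k <= `|M|.
    apply: (le_trans (singular_value_antitone TM cT (leq0n k))).
    apply: singular_value_le => //; apply: gelfand0 => x.
    by rewrite (le_trans (TM x))// ler_wpM2r ?rnorm_ge0 ?ler_norm.
  have -> : singular_value T k `^ r = singular_value T k `^ (r - q) * singular_value T k `^ q.
    by rewrite -powRD subrK// gt_eqF// (lt_le_trans q0).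
  rewrite ler_wpM2r ?powR_ge0// ge0_ler_powR ?nnegrE ?singular_value_ge0 ?subr_ge0//.
by apply: bounded_sumsZ => //; exact: powR_ge0.
Qed.

End Ideal.
End SchattenOps.

(** * The trace *)

Section Trace.
Variables (R : realType) (H : hilbert R).
Local Notation C := R[i].
Implicit Types (S T : {linear H -> H}) (phi : nat -> H -> C) (v e : nat -> H).

(** Coefficients are functionals phi_k rather than inner products with vectors:
    for S bounded, S T is then represented by (phi, S v) and T S by (phi S, v),
    without an adjoint of S. *)
Definition nuclear (T : H -> H) phi v :=
  [/\ forall k (a : C) x y, phi k (a *: x + y) = a * phi k x + phi k y,
      exists alpha : nat -> R, [/\ forall k, 0 <= alpha k,
        forall k x, rnorm (phi k x) <= alpha k * rnorm x &
        bounded_sums (fun k => alpha k * rnorm (v k))] &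
      forall x, sums (fun k => phi k x *: v k) (T x)].

Lemma trace_tends (T : H -> H) (t : C) :
  tends (fun n => \sum_(k < n) hip (T (xget (fun=> 0) (@hilbert_basis _ H) k))
                                   (xget (fun=> 0) (@hilbert_basis _ H) k)) t ->
  trace T = t.
Proof.
move=> h; rewrite /trace; apply: (@cvg_lim (R[i]^o)); first exact: norm_hausdorff.
apply/tends_cvg; rewrite (_ : series _ = fun n => \sum_(k < n)
  hip (T (xget (fun=> 0) (@hilbert_basis _ H) k)) (xget (fun=> 0) (@hilbert_basis _ H) k)).
  exact: h.
by apply: funext => n; rewrite /series /= big_mkord.
Qed.

(** The second case is that of the null family as a value of the choice that
    defines the trace; all trace identities are then trivial. *)
Lemma hilbert_basis_or_trace0 : (exists e, hilbert_basis e) \/ (forall T : H -> H, trace T = 0).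
Proof.
have [he|ne] := pselect (exists e : nat -> H, hilbert_basis e); first by left.
right=> T; apply: trace_tends; rewrite xgetPN => [|e he]; last by apply: ne; exists e.
rewrite (_ : (fun n => _) = fun=> 0); first exact: tends_cst.
by apply: funext => n; rewrite big1// => k _; rewrite hip0r.
Qed.

Lemma nuclear_abs_sums T phi v : nuclear T phi v ->
  exists t, sums (fun k => phi k (v k)) t.
Proof. by move=> [_ [alpha [_ phia ab]] _]; apply: abs_sums ab => k; exact: phia. Qed.

(** The sum of <T e_k, e_k> for k < n is the sum over k of phi_k(P_n v_k), where
    P_n projects onto the span of e_0, ..., e_(n-1), and P_n v_k tends to v_k. *)
Lemma nuclear_diag_tends T phi v e (t : C) : nuclear T phi v -> hilbert_basis e ->
  sums (fun k => phi k (v k)) t -> tends (fun n => \sum_(k < n) hip (T (e k)) (e k)) t.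
Proof.
move=> [phi_lin [alpha [alpha0 phia ab]] Tx] be tP.
have [oe _] := (hilbert_basisP e).1 be.
have phi0 k : phi k 0 = 0.
  by have := phi_lin k (-1) 0 0; rewrite scaler0 addr0 mulN1r addNr.
have phiB k x y : phi k x - phi k y = phi k (x - y).
  by rewrite addrC -mulN1r -phi_lin scaleN1r addrC.
pose a n k := phi k (proj e n (v k)).
have aE n k : a n k = \sum_(j < n) hip (phi k (e j) *: v k) (e j).
  rewrite /a /proj; elim/big_ind2 : _ => // [x s y u <- <-|j _].
    by have := phi_lin k 1 s u; rewrite scale1r mul1r.
  by have := phi_lin k (hip (v k) (e j)) (e j) 0; rewrite !addr0 phi0 addr0 hipZl mulrC => ->.
apply: (tannery (a := a) _ ab _ tP).
- by move=> n k; apply: (le_trans (phia k _)); rewrite ler_wpM2l ?rnorm_proj.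
- move=> n; rewrite (_ : a n = fun k => \sum_(j < n) hip (phi k (e j) *: v k) (e j)).
    apply: sums_sum => j; rewrite /sums (_ : (fun N => _) =
      fun N => hip (\sum_(k < N) phi k (e j) *: v k) (e j)).
      exact/hip_tends/Tx.
    by apply: funext => N; rewrite hip_suml.
  by apply: funext => k.
- move=> k; apply: (@tends_squeeze _ _ _ _ (fun n => alpha k * rnorm (proj e n (v k) - v k))).
    by move=> n; rewrite phiB phia.
  rewrite -[0 in X in _ --> X](mulr0 (alpha k)).
  by apply: cvgM; [exact: cvg_cst|exact: proj_tends].
Qed.

Lemma trace_nuclear T phi v : (exists e, hilbert_basis e) -> nuclear T phi v ->
  sums (fun k => phi k (v k)) (trace T).
Proof.
move=> [e0 be0] nT; have [t tP] := nuclear_abs_sums nT.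
suff -> : trace T = t by [].
apply: trace_tends; apply: nuclear_diag_tends nT _ tP.
by case: xgetP => [e _ //|/(_ e0)].
Qed.

(** T maps x minus its projection on e_0, ..., e_(n-1) to a vector of norm at
    most |T e_n| |x|, and |T e_n| tends to 0. *)
Lemma trace_class_nuclear T M e : bounded_by T M -> compact_op T -> singular_system T e ->
  bounded_sums (singular_value T) -> nuclear T (fun k x => hip x (e k)) (fun k => T (e k)).
Proof.
move=> TM cT eT sT; have [[_ e1] emax _ _] := eT; split.
- by move=> k a x y; rewrite hipDl hipZl.
- exists (fun=> 1); split=> [k|k x|]; first exact: ler01.
    rewrite mul1r (le_trans (cauchy_schwarz _ _))// ler_piMr ?rnorm_ge0//.
    by case: (e1 k) => ->; rewrite ?rnorm0// ler01.
  apply: (bounded_sums_le _ sT) => k.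
  by rewrite mul1r (singular_valueE _ TM eT).
- move=> x; apply: (@tends_squeeze _ _ _ _ (fun n => rnorm (T (e n)) * rnorm x)).
    move=> n; have -> : \sum_(k < n) hip x (e k) *: T (e k) = T (proj e n x).
      by rewrite linear_sum; apply: eq_bigr => k _; rewrite linearZ.
    rewrite rnorm_distC -linearB (le_trans (emax n _ _))//.
      by move=> i lin; rewrite proj_orth//; have [? _ _ _] := eT.
    by rewrite ler_wpM2l ?rnorm_ge0// rnorm_sub_proj//; have [? _ _ _] := eT.
  rewrite -[0 in X in _ --> X](mul0r (rnorm x)).
  by apply: cvgM; [exact: singular_system_cvg0 eT|exact: cvg_cst].
Qed.

Definition trace_class (T : H -> H) := schatten_op 1 T.

Lemma trace_class_bounded_sums T : trace_class T -> bounded_sums (singular_value T).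
Proof.
by move=> [_]; apply: bounded_sums_le => k; rewrite powRr1 ?singular_value_ge0.
Qed.

Lemma trace_class_nuclearP T M : bounded_by T M -> trace_class T ->
  exists phi v, nuclear T phi v.
Proof.
move=> TM T1; have [cT _] := T1; have [e eT] := singular_system_exists TM cT.
by do 2!eexists; exact: trace_class_nuclear TM cT eT (trace_class_bounded_sums T1).
Qed.

Lemma trace_class_tends T M : bounded_by T M -> trace_class T ->
  tends (fun n => \sum_(k < n) hip (T (xget (fun=> 0) (@hilbert_basis _ H) k))
                                   (xget (fun=> 0) (@hilbert_basis _ H) k)) (trace T).
Proof.
move=> TM T1; case: xgetP => [e _ be|ne].
  have [phi [v nT]] := trace_class_nuclearP TM T1.
  apply: (nuclear_diag_tends nT be); apply: trace_nuclear nT.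
  by exists e.
have [[e /ne//]|->] := hilbert_basis_or_trace0.
rewrite (_ : (fun n => _) = fun=> 0); first exact: tends_cst.
by apply: funext => n; rewrite big1// => k _; rewrite hip0r.
Qed.

Lemma traceP (z : C) S T (U : H -> H) M N : bounded_by S M -> bounded_by T N ->
  trace_class S -> trace_class T -> (forall x, U x = z *: S x + T x) ->
  trace U = z * trace S + trace T.
Proof.
move=> SM TN S1 T1 UE; apply: trace_tends; set e := xget _ _.
rewrite (_ : (fun n => _) = fun n => z * (\sum_(k < n) hip (S (e k)) (e k)) +
  \sum_(k < n) hip (T (e k)) (e k)); last first.
  apply: funext => n; rewrite mulr_sumr -big_split; apply: eq_bigr => k _.
  by rewrite UE hipDl hipZl.
apply: tendsD; last exact: trace_class_tends TN T1.
apply: (tends_lipschitz (f := fun y => z * y) (M := rnorm z) _ (trace_class_tends SM S1)).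
by move=> x y; rewrite -mulrBr rnormM.
Qed.

(** Both traces are the sum of phi_k(S v_k) if T is represented by (phi, v). *)
Lemma trace_mulC S T (U W : H -> H) M N : bounded_by S M -> bounded_by T N ->
  trace_class T -> (forall x, U x = S (T x)) -> (forall x, W x = T (S x)) ->
  trace U = trace W.
Proof.
move=> SM TN T1 /funext UE /funext WE; have [be|tr0] := hilbert_basis_or_trace0; last by rewrite !tr0.
have [phi [v [phi_lin [alpha [alpha0 phia ab]] Tx]]] := trace_class_nuclearP TN T1.
have SM' x : rnorm (S x) <= `|M| * rnorm x.
  by rewrite (le_trans (SM _))// ler_wpM2r ?rnorm_ge0// ler_norm.
pose UL : {linear H -> H} := S \o T; pose WL : {linear H -> H} := T \o S.
have nU : nuclear UL phi (fun k => S (v k)).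
  split=> //.
    exists alpha; split=> //.
    apply: (bounded_sums_le _ (bounded_sumsZ (normr_ge0 M) ab)) => k.
    by rewrite mulrCA ler_wpM2l.
  move=> x; rewrite /sums (_ : (fun n => _) = fun n => S (\sum_(k < n) phi k x *: v k)).
    exact: tends_linear SM (Tx x).
  by apply: funext => n; rewrite linear_sum; apply: eq_bigr => k _; rewrite linearZ.
have nW : nuclear WL (fun k x => phi k (S x)) v.
  split=> [||x]; last exact: Tx.
  - by move=> k a x y; rewrite linearP phi_lin.
  - exists (fun k => alpha k * `|M|); split=> [k|k x|]; first by rewrite mulr_ge0.
      by rewrite (le_trans (phia _ _))// -mulrA ler_wpM2l.
    apply: (bounded_sums_le _ (bounded_sumsZ (normr_ge0 M) ab)) => k.
    by rewrite mulrAC mulrC.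
have tU := trace_nuclear be nU; have tW := trace_nuclear be nW.
rewrite UE WE; exact: sums_unique tU tW.
Qed.

Lemma trace_finite_rank T K phi v : (exists e, hilbert_basis e) ->
  (forall k (a : C) x y, phi k (a *: x + y) = a * phi k x + phi k y) ->
  (exists alpha : nat -> R, forall k x, rnorm (phi k x) <= alpha k * rnorm x) ->
  (forall x, T x = \sum_(k < K) phi k x *: v k) ->
  trace T = \sum_(k < K) phi k (v k).
Proof.
move=> be phi_lin [alpha phia] TE.
pose w k := if (k < K)%N then v k else 0.
have finite (V : normedZmodType C) (a : nat -> V) :
    (forall k, (K <= k)%N -> a k = 0) -> sums a (\sum_(k < K) a k).
  move=> aK; apply/tendsP => d d0; exists K => // n /= Kn.
  rewrite -!(big_mkord xpredT a) (@big_cat_nat _ _ _ K)//=.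
  have -> : \sum_(K <= k < n) a k = 0.
    by rewrite big_nat_cond big1// => k /andP[/andP[Kk _] _]; exact: aK.
  by rewrite addr0 subrr rnorm0.
have wK k : (K <= k)%N -> w k = 0 by rewrite /w ltnNge => ->.
have wE (k : 'I_K) : w k = v k by rewrite /w ltn_ord.
have phi0 k : phi k 0 = 0.
  by have := phi_lin k (-1) 0 0; rewrite scaler0 addr0 mulN1r addNr.
have nT : nuclear T phi w.
  split=> //.
    exists (fun k => `|alpha k|); split=> // [k x|].
      by rewrite (le_trans (phia k x))// ler_wpM2r ?rnorm_ge0// ler_norm.
    exists (\sum_(k < K) `|alpha k| * rnorm (w k)) => n.
    pose b k := `|alpha k| * rnorm (w k).
    have b0 k : 0 <= b k by rewrite mulr_ge0 ?rnorm_ge0.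
    apply: (le_trans (ler_psum b0 (leq_maxl n K))).
    rewrite -!(big_mkord xpredT b) (@big_cat_nat _ _ _ K)//= ?leq_maxr//.
    have -> : \sum_(K <= k < maxn n K) b k = 0.
      by rewrite big_nat_cond big1// => k /andP[/andP[Kk _] _]; rewrite /b wK// rnorm0 mulr0.
    by rewrite addr0.
  move=> x; rewrite TE (eq_bigr (fun k : 'I_K => phi k x *: w k)) => [|k _]; last by rewrite wE.
  by apply: finite => k Kk; rewrite wK// scaler0.
apply: (sums_unique (trace_nuclear be nT)).
rewrite (eq_bigr (fun k : 'I_K => phi k (w k))) => [|k _]; last by rewrite wE.
by apply: finite => k Kk; rewrite wK.
Qed.

End Trace.

Section Cyclicity.
Variables (R : realType) (H : hilbert R).
Local Notation C := R[i].

(** The f_k = T e_k / |T e_k|, or 0 if T e_k = 0, are the left singular vectors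
    of T. *)
Lemma proj_intertwine (T : {linear H -> H}) e : singular_system T e ->
  exists f, orthosys f /\ forall K x, proj f K (T x) = T (proj e K x).
Proof.
move=> eT; have [_ _ eig _] := eT.
pose lam k := rnorm (T (e k)).
pose f k := (lam k)^-1%:C%C *: T (e k); exists f; split.
  split=> [i j ij|k]; first by rewrite hipZl hipZr (singular_system_orth eT)// !mulr0.
  have [l0|l0] := eqVneq (lam k) 0; first by left; rewrite /f l0 invr0 scale0r.
  by right; rewrite rnormZ rnorm_real ger0_norm ?invr_ge0 ?rnorm_ge0// mulVf.
move=> K x; rewrite /proj linear_sum; apply: eq_bigr => k _.
rewrite [RHS]linearZ_LR /f hipZr scalerA mulrC mulrA [hip (T x) _]hipC eig -/(lam k).
have [l0|l0] := eqVneq (lam k) 0; first by rewrite (rnorm_eq0 l0) !scaler0.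
have conjR (r : R) : Num.conj r%:C%C = r%:C%C by exact: conjc_real.
congr (_ *: _); rewrite [Num.conj (_ * hip _ _)]rmorphM /= -hipC !conjR mulrA -!rmorphM.
by rewrite -expr2 -exprMn mulVf// expr1n mul1r.
Qed.

(** Truncating T = sum_k <., e_k> T e_k after K terms makes both traces equal to
    sum_(k < K) <S T e_k, e_k>. The truncation multiplies S T and T S by
    projections, and these traces converge by dominated convergence along the
    singular systems of S T and T S. *)
Lemma trace_cyclic (S T U W : {linear H -> H}) (M N : R) :
  bounded_by S M -> bounded_by T N -> compact_op T ->
  (forall x, U x = S (T x)) -> (forall x, W x = T (S x)) ->
  trace_class U -> trace_class W -> trace U = trace W.
Proof.
move=> SM TN cT UE WE U1 W1; have [be|tr0] := @hilbert_basis_or_trace0 R H; last by rewrite !tr0.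
have SM' x : rnorm (S x) <= `|M| * rnorm x.
  by rewrite (le_trans (SM _))// ler_wpM2r ?rnorm_ge0// ler_norm.
have TN' x : rnorm (T x) <= `|N| * rnorm x.
  by rewrite (le_trans (TN _))// ler_wpM2r ?rnorm_ge0// ler_norm.
have UB : bounded_by U (`|M| * `|N|).
  by move=> x; rewrite UE (le_trans (SM' _))// -mulrA ler_wpM2l.
have WB : bounded_by W (`|N| * `|M|).
  by move=> x; rewrite WE (le_trans (TN' _))// -mulrA ler_wpM2l.
have [e eT] := singular_system_exists TN cT; have [oe emax _ _] := eT.
have [g gU] := singular_system_exists UB U1.1; have [og _ geig _] := gU.
have [h hW] := singular_system_exists WB W1.1; have [oh _ _ _] := hW.
have nU := trace_class_nuclear UB U1.1 gU (trace_class_bounded_sums U1).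
have nW := trace_class_nuclear WB W1.1 hW (trace_class_bounded_sums W1).
have e1 (e' : nat -> H) k : orthosys e' -> rnorm (e' k) <= 1.
  by move=> [_ e'1]; case: (e'1 k) => ->; rewrite ?rnorm0// ler01.
have hip1 (e' : nat -> H) k x : orthosys e' -> rnorm (hip x (e' k)) <= rnorm x.
  by move=> oe'; rewrite (le_trans (cauchy_schwarz _ _))// ler_piMr ?rnorm_ge0 ?e1.
pose tau K := \sum_(k < K) hip (S (T (e k))) (e k).
have lam0 c : (rnorm (T (e K)) * c @[K --> \oo] --> (0 : R)).
  rewrite -[0 in X in _ --> X](mul0r c).
  by apply: cvgM; [exact: singular_system_cvg0 eT|exact: cvg_cst].
have tail K x : rnorm (T (x - proj e K x)) <= rnorm (T (e K)) * rnorm x.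
  rewrite (le_trans (emax K _ _))//; first by move=> i iK; rewrite proj_orth.
  by rewrite ler_wpM2l ?rnorm_ge0// rnorm_sub_proj.
(* Truncations are nuclear too, with the same functionals and dominated
   vectors: dominated convergence applies to their traces. *)
have nproj (e' : nat -> H) K (V : {linear H -> H}) (g' : nat -> H) : orthosys e' -> orthosys g' ->
    nuclear V (fun k x => hip x (g' k)) (fun k => V (g' k)) ->
    nuclear (proj e' K \o V) (fun k x => hip x (g' k)) (fun k => proj e' K (V (g' k))).
  move=> oe' og' [phi_lin [alpha [a0 phia ab]] Vx]; split=> //.
    exists alpha; split=> //; apply: (bounded_sums_le _ ab) => k.
    by rewrite ler_wpM2l// rnorm_proj.
  move=> x; rewrite /sums (_ : (fun n => _) =
    fun n => proj e' K (\sum_(k < n) hip x (g' k) *: V (g' k))).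
    by apply: (@tends_linear _ _ _ _ 1) (Vx x) => y; rewrite mul1r rnorm_proj.
  by apply: funext => n; rewrite linear_sum; apply: eq_bigr => k _; rewrite linearZ.
have bound (V : {linear H -> H}) (e' g' : nat -> H) K k : orthosys e' -> orthosys g' ->
    rnorm (hip (proj e' K (V (g' k))) (g' k)) <= rnorm (V (g' k)).
  by move=> oe' og'; rewrite (le_trans (hip1 _ _ _ og'))// rnorm_proj.
have bsum (V : {linear H -> H}) M' g' : bounded_by V M' -> singular_system V g' ->
    trace_class V -> bounded_sums (fun k => rnorm (V (g' k))).
  move=> VM' Vg' V1; apply: (bounded_sums_le _ (trace_class_bounded_sums V1)) => k.
  by rewrite (singular_valueE _ VM' Vg').
have tauU : tends tau (trace U).
  apply: (tannery (a := fun K k => hip (proj e K (U (g k))) (g k)) _ (bsum _ _ _ UB gU U1) _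
    (trace_nuclear be nU)) => [K k|K|k].
  - exact: bound.
  - have := trace_nuclear be (nproj e K U g oe og nU).
    rewrite (@trace_finite_rank _ _ _ K (fun k x => hip (U x) (e k)) e)//.
    + by rewrite (eq_bigr (fun k : 'I_K => hip (S (T (e k))) (e k))) => [|k _]; rewrite ?UE.
    + by move=> k a x y; rewrite linearP hipDl hipZl.
    + exists (fun=> `|M| * `|N|) => k x.
      by rewrite (le_trans (hip1 _ _ _ oe)).
  - apply: (@tends_squeeze _ _ _ _ (fun K => rnorm (T (e K)) * `|M|)) => // K.
    (* |v|^2 <x, g_k> = <U x, v>, as g_k is an eigenvector of U^* U, and U x = S T x
       is small since x is orthogonal to e_0, ..., e_(K-1). *)
    set v := U (g k); rewrite rnorm_distC -hipBl; set x := v - _.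
    have [v0|v0] := eqVneq (rnorm v) 0.
      by rewrite /x (rnorm_eq0 v0) linear0 subrr hip0l rnorm0 mulr_ge0 ?rnorm_ge0.
    have vpos : 0 < rnorm v by rewrite lt_def v0 rnorm_ge0.
    have : rnorm (hip (U x) v) = rnorm v ^+ 2 * rnorm (hip x (g k)).
      rewrite hipC rnorm_conj geig rnormM rnorm_real ger0_norm ?sqr_ge0//.
      by rewrite hipC rnorm_conj.
    have := cauchy_schwarz (U x) v => /[swap] ->.
    rewrite expr2 mulrAC ler_pM2r// => /le_trans h'.
    rewrite -(ler_pM2l vpos); apply: h'; rewrite UE (le_trans (SM' _))//.
    by rewrite mulrC mulrA ler_wpM2r// [rnorm v * _]mulrC tail.
have [f [of_ fT]] := proj_intertwine eT.
have tauW : tends tau (trace W).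
  apply: (tannery (a := fun K k => hip (proj f K (W (h k))) (h k)) _ (bsum _ _ _ WB hW W1) _
    (trace_nuclear be nW)) => [K k|K|k].
  - exact: bound.
  - have := trace_nuclear be (nproj f K W h of_ oh nW).
    rewrite (@trace_finite_rank _ _ _ K (fun k x => hip (S x) (e k)) (fun k => T (e k)))//.
    + by move=> k a x y; rewrite linearP hipDl hipZl.
    + exists (fun=> `|M|) => k x.
      by rewrite (le_trans (hip1 _ _ _ oe)).
    + move=> x; rewrite /= WE fT linear_sum; apply: eq_bigr => k _; by rewrite linearZ.
  - apply: (@tends_squeeze _ _ _ _ (fun K => rnorm (T (e K)) * rnorm (S (h k)))) => // K.
    by rewrite rnorm_distC -hipBl (le_trans (hip1 _ _ _ oh))// WE fT -linearB tail.
exact: tends_unique tauU tauW.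
Qed.

End Cyclicity.

(** * Schatten ideals and traces of natural transformations *)

Section HomSchatten.
Variables (R : realType) (X : rigid_Cstar_tensor_category R) (H : hilbX X).
Variables (I : finType) (irr : I -> X).
Local Notation C := R[i].
Local Notation E := (hilbX_hom H H).
Implicit Types (s t : E) (p q r : R).

Lemma nt_bounded_by s : exists M : R, forall c, bounded_by (s c) M.
Proof.
have [M M0 sM] := nt_boundedP s; exists (complex.Re M) => c x.
by rewrite -lecR rmorphM /= -!rnormE (RRe_real (ger0_real M0)) sM.
Qed.

Lemma schattenP q s : 0 < q -> schatten irr q s <->
  (forall c, compact_op (s c)) /\ forall i, schatten_op q (s (irr i)).
Proof.
move=> q0; split=> [[cs sq]|[cs sq]]; split=> //.
  move=> i; split=> //; apply/(schatten_normP _ q0).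
  by apply: le_lt_trans sq; apply: ereal_sup_ubound; exists i.
have sq' i : (schatten_norm q (s (irr i)) < +oo)%E.
  by apply/(schatten_normP _ q0); have [] := sq i.
apply: (@le_lt_trans _ _ (\big[maxe/-oo%E]_i schatten_norm q (s (irr i)))).
  by apply: ge_ereal_sup => _ [i _ <-]; exact: le_bigmax.
by apply/bigmax_ltP; split=> // i _; exact: sq'.
Qed.

Lemma schatten_compact q s c : schatten irr q s -> compact_op (s c).
Proof. by case=> + _; apply. Qed.

Lemma schattenMl q s t : 0 < q -> schatten irr q t -> schatten irr q (s * t).
Proof.
move=> q0 /(schattenP _ q0)[ct tq]; have [M sM] := nt_bounded_by s.
have [N tN] := nt_bounded_by t.
apply/(schattenP _ q0); split=> [c|i]; first exact: compact_op_mull (sM c) (ct c).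
exact: (schatten_op_mull (S := s (irr i)) (T := t (irr i)) (U := (s * t) (irr i)) q0
  (sM _) (tN _) (fun=> erefl) (tq i)).
Qed.

Lemma schattenMr q s t : 0 < q -> schatten irr q s -> schatten irr q (s * t).
Proof.
move=> q0 /(schattenP _ q0)[cs sq]; have [M sM] := nt_bounded_by s.
have [N tN] := nt_bounded_by t.
apply/(schattenP _ q0); split=> [c|i]; first exact: compact_op_mulr (tN c) (cs c).
exact: (schatten_op_mulr (S := s (irr i)) (T := t (irr i)) (U := (s * t) (irr i)) q0
  (sM _) (tN _) (fun=> erefl) (sq i)).
Qed.

Lemma schattenM q r p s t : 0 < q -> 0 < r -> 0 < p -> p^-1 = q^-1 + r^-1 ->
  schatten irr q s -> schatten irr r t -> schatten irr p (s * t).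
Proof.
move=> q0 r0 p0 pE /(schattenP _ q0)[cs sq] /(schattenP _ r0)[ct tr].
have [M sM] := nt_bounded_by s; have [N tN] := nt_bounded_by t.
apply/(schattenP _ p0); split=> [c|i]; first exact: compact_op_mulr (tN c) (cs c).
exact: (schatten_opM (S := s (irr i)) (T := t (irr i)) (U := (s * t) (irr i)) q0 r0 p0 pE
  (sM _) (tN _) (fun=> erefl) (sq i) (tr i)).
Qed.

Lemma schattenD q s t : 0 < q -> schatten irr q s -> schatten irr q t ->
  schatten irr q (s + t).
Proof.
move=> q0 /(schattenP _ q0)[cs sq] /(schattenP _ q0)[ct tq].
have [M sM] := nt_bounded_by s; have [N tN] := nt_bounded_by t.
apply/(schattenP _ q0); split=> [c|i].
  have -> : (s + t) c = (fun x => s c x + t c x) :> (H c -> H c).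
    by apply: funext => x; rewrite homDE.
  exact: compact_opD.
exact: (schatten_opD (S := s (irr i)) (T := t (irr i)) (U := (s + t) (irr i)) q0
  (sM _) (tN _) (homDE s t (c := irr i)) (sq i) (tq i)).
Qed.

Lemma schattenZ q (z : C) s : 0 < q -> schatten irr q s -> schatten irr q (z *: s).
Proof. by move=> q0 sq; rewrite -[s]mul1r homscaleAl; exact: schattenMl. Qed.

Lemma schatten0 q : 0 < q -> schatten irr q (0 : E).
Proof.
move=> q0; apply/(schattenP _ q0).
have c0 c : compact_op ((0 : E) c).
  by apply: (@compact_op_in _ _ _ _ [set 0]) => //; exact: compact_set1.
split=> // i; split=> //; exists 0 => n; rewrite big1// => k _.
suff -> : singular_value ((0 : E) (irr i)) k = 0 by rewrite powR0 ?gt_eqF.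
apply/eqP; rewrite eq_le singular_value_ge0 andbT.
have b0 : bounded_by ((0 : E) (irr i)) 0 by move=> x; rewrite rnorm0 mul0r.
apply: (le_trans (singular_value_antitone b0 (c0 _) (leq0n k))).
by apply: singular_value_le => //; exact: gelfand0.
Qed.

Lemma schatten_le q r s : 0 < q -> q <= r -> schatten irr q s -> schatten irr r s.
Proof.
move=> q0 qr /(schattenP _ q0)[cs sq]; have [M sM] := nt_bounded_by s.
apply/(schattenP _ (lt_le_trans q0 qr)); split=> // i.
exact: schatten_op_le (sM _) (sq i).
Qed.

Lemma TraceP (z : C) s t : schatten irr 1 s -> schatten irr 1 t ->
  Trace irr (z *: s + t) = z * Trace irr s + Trace irr t.
Proof.
move=> /(schattenP _ ltr01)[_ s1] /(schattenP _ ltr01)[_ t1].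
have [M sM] := nt_bounded_by s; have [N tN] := nt_bounded_by t.
rewrite /Trace mulr_sumr -big_split; apply: eq_bigr => i _.
by apply: (traceP (sM _) (tN _) (s1 i) (t1 i)) => x; rewrite homDE homscaleE.
Qed.

Lemma Trace0 : Trace irr (0 : E) = 0.
Proof.
have := TraceP (-1) (schatten0 ltr01) (schatten0 ltr01).
by rewrite scaler0 addr0 mulN1r addNr.
Qed.

Lemma TraceZ (z : C) s : schatten irr 1 s -> Trace irr (z *: s) = z * Trace irr s.
Proof.
by move=> s1; have := TraceP z s1 (schatten0 ltr01); rewrite addr0 Trace0 addr0.
Qed.

Lemma TraceD s t : schatten irr 1 s -> schatten irr 1 t ->
  Trace irr (s + t) = Trace irr s + Trace irr t.
Proof. by move=> s1 t1; have := TraceP 1 s1 t1; rewrite scale1r mul1r. Qed.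

Lemma Trace_mulC s t : schatten irr 1 t -> Trace irr (s * t) = Trace irr (t * s).
Proof.
move=> /(schattenP _ ltr01)[_ t1].
have [M sM] := nt_bounded_by s; have [N tN] := nt_bounded_by t.
apply: eq_bigr => i _.
exact: (trace_mulC (sM (irr i)) (tN (irr i)) (t1 i)).
Qed.

Lemma Trace_cyclic s t : (forall c, compact_op (t c)) ->
  schatten irr 1 (s * t) -> schatten irr 1 (t * s) ->
  Trace irr (s * t) = Trace irr (t * s).
Proof.
move=> ct /(schattenP _ ltr01)[_ st1] /(schattenP _ ltr01)[_ ts1].
have [M sM] := nt_bounded_by s; have [N tN] := nt_bounded_by t.
apply: eq_bigr => i _.
exact: (trace_cyclic (U := (s * t) (irr i)) (W := (t * s) (irr i))
  (sM (irr i)) (tN (irr i)) (ct _) (fun=> erefl) (fun=> erefl) (st1 i) (ts1 i)).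
Qed.

End HomSchatten.

(** * Fredholm modules *)

Section FredholmModule.
Variables (R : realType) (X : rigid_Cstar_tensor_category R).
Variables (I : finType) (irr : I -> X) (A : assoc_algebra R) (p : R).
Hypothesis p_gt0 : 0 < p.
Variable M : fredholm_module irr A p.
Local Notation C := R[i].
Local Notation E := (hilbX_hom (fm_H M) (fm_H M)).
Implicit Types s t w : E.

(** By Hoelder's inequality p / j is the exponent of a product of j operators of
    exponent p; for j = 0 there is only boundedness. *)
Definition schatten_pow (j : nat) s : Prop :=
  if j is 0%N then True else schatten irr (p / j%:R) s.

Let p_div j : 0 < p / j.+1%:R. Proof. by rewrite divr_gt0. Qed.

Lemma schatten_powP j (z : C) s t : schatten_pow j s -> schatten_pow j t ->
  schatten_pow j (z *: s + t).
Proof.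
case: j => [|j] sj tj; first exact: Logic.I.
apply: (schattenD (p_div j) _ tj); exact: schattenZ (p_div j) sj.
Qed.

Lemma schatten_pow0 j : schatten_pow j 0.
Proof. by case: j => [|j]; [exact: Logic.I|exact: schatten0 (p_div j)]. Qed.

Lemma schatten_powM i j s t : schatten_pow i s -> schatten_pow j t ->
  schatten_pow (i + j) (s * t).
Proof.
case: i j => [|i] [|j] si tj.
- exact: Logic.I.
- exact: schattenMl (p_div j) tj.
- by rewrite addn0; exact: schattenMr (p_div i) si.
apply: (schattenM (p_div i) (p_div j) (p_div _) _ si tj).
by rewrite !invf_div -mulrDl -natrD.
Qed.

Lemma schatten_pow_compact j s c : schatten_pow j.+1 s -> compact_op (s c).
Proof. exact: schatten_compact. Qed.

Lemma gcommP (z : C) s t : fm_gcomm M (z *: s + t) = z *: fm_gcomm M s + fm_gcomm M t.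
Proof.
rewrite /fm_gcomm !gcommE !(mulrDr, mulrDl) -!(homscaleAr, homscaleAl).
by rewrite opprD addrACA -scalerBr.
Qed.

Lemma gcomm0 : fm_gcomm M 0 = 0.
Proof. by rewrite /fm_gcomm gcommE !(mulr0, mul0r) subrr. Qed.

Lemma gcommZ (z : C) s : fm_gcomm M (z *: s) = z *: fm_gcomm M s.
Proof. by have := gcommP z s 0; rewrite gcomm0 !addr0. Qed.

Lemma gcomm_gdiff s : fm_gcomm M s = - 'i%C *: fm_d M s.
Proof. by rewrite /fm_d /gdiff scalerA mulNr -expr2 sqr_i opprK scale1r. Qed.

Lemma schatten_pow_d_rho1 (a : unitization A) : schatten_pow 1 (fm_d M (fm_rho1 M a)).
Proof.
rewrite /schatten_pow divr1 /fm_d /gdiff gcomm_even; last exact: fm_rho1_even.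
  rewrite /fm_rho1 mulrDr mulrDl -homscaleAr -homscaleAl mulr1 mul1r opprD addrACA subrr addr0.
  by apply: schattenZ => //; exact: fm_summable.
exact: fm_eps2.
Qed.

Lemma schatten_pow_Omega j w : Omega M j w -> schatten_pow j w.
Proof.
apply: Omega_ind => [|z s t|a l <-]; [exact: schatten_pow0|exact: schatten_powP|].
rewrite -[size l]add0n; apply: schatten_powM; first exact: Logic.I.
elim: l => [|b l IH]; first exact: Logic.I.
by rewrite big_cons; apply: (@schatten_powM 1) IH; exact: schatten_pow_d_rho1.
Qed.

Lemma Omega_gcomm j w : Omega M j w -> Omega M j.+1 (fm_gcomm M w).
Proof.
move=> /Omega_d dw; rewrite gcomm_gdiff -[_ *: _]addr0.
by apply: lspanP dw _; exact: lspan0.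
Qed.

Local Notation e := (fm_eps M).
Local Notation F := (fm_F M).
Local Notation c := (fm_gcomm M).

Let ee : e * e = 1. Proof. exact: fm_eps2. Qed.
Let FF : F * F = 1. Proof. exact: fm_F2. Qed.
Let Fe : F * e = - (e * F). Proof. exact: fm_Feps. Qed.
Let eF : e * F = - (F * e). Proof. by rewrite Fe opprK. Qed.

Lemma gcommM s t : c (s * t) = c s * t + e * s * e * c t.
Proof.
rewrite /fm_gcomm !gcommE mulrBl mulrBr !mulrA addrA subrK.
by rewrite -[e * s * e * e]mulrA ee mulr1.
Qed.

Lemma gcomm_gcomm s : c (c s) = 0.
Proof.
have := fm_dd (M := M) s; rewrite /fm_d /gdiff -/(fm_gcomm M _) -/(fm_gcomm M _) gcommZ scalerA.
by rewrite -expr2 sqr_i scaleN1r => /eqP; rewrite oppr_eq0 => /eqP.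
Qed.

(** As [F, [F, s]] = 0, the element [F, s] commutes with epsilon F. *)
Lemma epsF_gcomm s : e * F * c s = c s * (e * F).
Proof.
have Fc : F * c s = e * c s * e * F.
  by apply/eqP; rewrite -subr_eq0 -gcommE; apply/eqP; exact: gcomm_gcomm.
by rewrite -mulrA Fc !mulrA ee mul1r -!mulrA.
Qed.

(** [F, s] commutes with F and epsilon, hence F [F, s] anticommutes with epsilon,
    and the trace of its product with epsilon changes sign when the two factors
    are exchanged. *)
Lemma Tr_s_odd s : schatten irr 1 (c s) -> odd_deg e s -> Tr_s M s = 0.
Proof.
move=> cs1 os; rewrite /Tr_s.
have cE : c s = F * s + s * F by rewrite /fm_gcomm gcomm_odd.
have Fc : F * c s = c s * F.
  by rewrite cE mulrDr mulrDl !mulrA FF mul1r -[s * F * F]mulrA FF mulr1 addrC.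
have Fc1 : schatten irr 1 (F * c s) := schattenMl F ltr01 cs1.
have ec : e * c s = c s * e.
  have eFs : e * (F * s) = F * s * e.
    by rewrite mulrA eF mulNr -[F * e * s]mulrA os mulrN opprK mulrA.
  have esF : e * (s * F) = s * F * e.
    by rewrite mulrA os mulNr -!mulrA Fe mulrN.
  by rewrite cE mulrDr mulrDl eFs esF.
have anti : F * c s * e = - (e * F * c s).
  by rewrite -mulrA -ec mulrA Fe mulNr.
have Fc1' : schatten irr 1 (e * F * c s) := schattenMl (e * F) ltr01 cs1.
have h : Trace irr (e * F * c s) = - Trace irr (e * F * c s).
  transitivity (Trace irr (F * c s * e)).
    by rewrite -(mulrA e) (Trace_mulC e Fc1).
  by rewrite anti -scaleN1r (TraceZ _ Fc1') mulN1r.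
suff -> : Trace irr (e * F * c s) = 0 by rewrite mulr0.
by apply/eqP; move/eqP: h; rewrite -subr_eq0 opprK -mulr2n mulrn_eq0.
Qed.

(** epsilon F [F, s] = epsilon s + F s epsilon F, where both terms have the same
    trace by cyclicity. *)
Lemma Tr_s_schatten1 s : schatten irr 1 s -> Tr_s M s = Trace irr (e * s).
Proof.
move=> s1; rewrite /Tr_s.
have es1 : schatten irr 1 (e * s) := schattenMl e ltr01 s1.
have seF1 : schatten irr 1 (s * e * F) := schattenMr F ltr01 (schattenMr e ltr01 s1).
have FseF1 : schatten irr 1 (F * (s * e * F)) := schattenMl F ltr01 seF1.
have -> : e * F * c s = e * s + F * (s * e * F).
  rewrite /fm_gcomm gcommE mulrBr !mulrA -[e * F * F]mulrA FF mulr1.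
  have -> : e * F * e = - F by rewrite eF mulNr -mulrA ee mulr1.
  by rewrite !mulNr opprK.
rewrite (TraceD es1 FseF1) (Trace_mulC F seF1) -[s * e * F * F]mulrA FF mulr1 (Trace_mulC e s1).
by move: (Trace irr (s * e)) => tr; field.
Qed.

Variable n : nat.
Hypothesis n_ge : p - 1 <= n%:R.

Lemma schatten_pow_trace_class s : schatten_pow n.+1 s -> schatten irr 1 s.
Proof.
apply: schatten_le; first exact: p_div.
by rewrite ler_pdivrMr// mul1r -natr1; move: n_ge; lra.
Qed.

(** [F, w] is a combination of products of n + 1 >= p commutators [F, rho a]. *)
Lemma gcomm_trace_class w : Omega M n w -> schatten irr 1 (c w).
Proof. by move=> /Omega_gcomm /schatten_pow_Omega; exact: schatten_pow_trace_class. Qed.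

Lemma mul_gcomm_trace_class i j s t : (i + j)%N = n -> Omega M i s -> Omega M j t ->
  schatten irr 1 (s * c t) /\ schatten irr 1 (c t * s).
Proof.
move=> ijn Os Ot; split; apply: schatten_pow_trace_class; apply: schatten_pow_Omega.
  by rewrite -ijn -addnS; apply: OmegaM => //; exact: Omega_gcomm.
by rewrite -ijn addnC -addSn; apply: OmegaM => //; exact: Omega_gcomm.
Qed.

(** The factors are epsilon F s and [F, t], which commutes with epsilon F. Only
    their products need to be trace class. *)
Lemma Trace_gcomm_cyclic i j s t : (i + j)%N = n -> Omega M i s -> Omega M j t ->
  Trace irr (e * F * (s * c t)) = Trace irr (e * F * (c t * s)).
Proof.
move=> ijn Os Ot; have [st1 ts1] := mul_gcomm_trace_class ijn Os Ot.
rewrite [e * F * (c t * s)]mulrA epsF_gcomm -[c t * (e * F) * s]mulrA [e * F * (s * _)]mulrA.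
apply: Trace_cyclic.
- by move=> a; apply: (@schatten_pow_compact j); exact: schatten_pow_Omega (Omega_gcomm Ot).
- by rewrite -mulrA; exact: (schattenMl (e * F) ltr01 st1).
- by rewrite mulrA -epsF_gcomm -mulrA; exact: (schattenMl (e * F) ltr01 ts1).
Qed.

Lemma Tr_sP (z : C) s t : Omega M n s -> Omega M n t ->
  Tr_s M (z *: s + t) = z * Tr_s M s + Tr_s M t.
Proof.
move=> Os Ot; rewrite /Tr_s gcommP mulrDr -homscaleAr.
rewrite (TraceP z (schattenMl (e * F) ltr01 (gcomm_trace_class Os))
  (schattenMl (e * F) ltr01 (gcomm_trace_class Ot))).
by rewrite mulrDr mulrCA.
Qed.

Lemma Tr_s_d s : Tr_s M (fm_d M s) = 0.
Proof.
by rewrite /Tr_s /fm_d /gdiff -/(fm_gcomm M _) gcommZ gcomm_gcomm scaler0 mulr0 Trace0 mulr0.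
Qed.

Lemma Tr_s_mulE i j s t : (i + j)%N = n -> Omega M i s -> Omega M j t ->
  Tr_s M (s * t) = 2^-1 * (Trace irr (e * F * (c s * t)) +
                           (-1) ^+ i * Trace irr (e * F * (c t * s))).
Proof.
move=> ijn Os Ot; have [st1 _] := mul_gcomm_trace_class ijn Os Ot.
have [_ ts1] := mul_gcomm_trace_class (etrans (addnC j i) ijn) Ot Os.
have es : e * s * e = (-1) ^+ i *: s by exact: Omega_conj_eps Os.
rewrite /Tr_s gcommM es mulrDr -homscaleAl -homscaleAr; congr (_ * _).
have cst := schattenMl (e * F) ltr01 ts1; have sct := schattenMl (e * F) ltr01 st1.
rewrite (TraceD cst (schattenZ _ ltr01 sct)) (TraceZ _ sct).
by rewrite (Trace_gcomm_cyclic ijn Os Ot).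
Qed.

(** The two summands of Tr_s (s t) are, up to sign, those of Tr_s (t s) in
    reverse order. As n is even, i, j and i j have the same parity, which makes
    the signs match. *)
Lemma Tr_s_graded i j s t : ~~ odd n -> (i + j)%N = n -> Omega M i s -> Omega M j t ->
  Tr_s M (s * t) = (-1) ^+ (i * j) * Tr_s M (t * s).
Proof.
move=> n_even ijn Os Ot.
rewrite (Tr_s_mulE ijn Os Ot) (Tr_s_mulE (etrans (addnC j i) ijn) Ot Os).
have oij : odd i = odd j by move: n_even; rewrite -ijn oddD; case: (odd i); case: (odd j).
rewrite -signr_odd -[(-1) ^+ j]signr_odd -[(-1) ^+ (i * j)]signr_odd oddM -oij andbb.
move: (Trace irr _) (Trace irr _) => a b.
by case: (odd i) => /=; rewrite ?expr0 ?expr1; ring.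
Qed.

End FredholmModule.

Theorem lemma4p4 (R : realType) (X : rigid_Cstar_tensor_category R)
    (I : finType) (irr : I -> X) (irrP : is_Irr irr)
    (A : assoc_algebra R) (p : R) (p_ge1 : 1 <= p)
    (M : fredholm_module irr A p)
    (m n : nat) (nE : n = (2 * m)%N) (n_ge : p - 1 <= n%:R) :
  [/\ forall th, schatten irr 1 (fm_gcomm M th) ->
        odd_deg (fm_eps M) th -> Tr_s M th = 0,
      forall th, schatten irr 1 th -> Tr_s M th = Trace irr (fm_eps M * th),
      forall w, Omega M n w -> schatten irr 1 (fm_gcomm M w) &
      closed_graded_trace (Omega_dga M) n (Tr_s M)].
Proof.
have p0 : 0 < p by exact: lt_le_trans ltr01 p_ge1.
have n_even : ~~ odd n by rewrite nE oddM.
split.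
- exact: Tr_s_odd.
- exact: Tr_s_schatten1.
- by move=> w; exact: (gcomm_trace_class p0 n_ge).
split.
- by move=> z s t; exact: (Tr_sP p0 n_ge).
- by move=> j s _ _; exact: Tr_s_d.
- by move=> i j s t ijn; exact: (Tr_s_graded p0 n_ge n_even ijn).
Qed.
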